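(* (Mean capacity in the interference power limited regime, $P_{\max}\to\infty$.) In this regime the asymptotic distribution function of the per-antenna SINR is written as $$F(x)=1-c_p\frac{Q\overline g}{x\overline h},\qquad c_p=\frac{e^{\sigma^2/(P_p\overline q)}\,\Gamma\left(0,\frac{\sigma^2}{P_p\overline q}\right)}{P_p\,\overline q},$$ with inverse $F^{-1}(y)=c_p\frac{Q\overline g}{(1-y)\overline h}$. The normalizing constants of the Gumbel distribution for the secondary user's rate are then $$a_N=\log\left(1+c_p\frac{Q\overline g}{\overline h}N\right),\qquad b_N=\log\left(\frac{1+c_p\frac{Q\overline g}{\overline h}Ne}{1+c_p\frac{Q\overline g}{\overline h}N}\right),$$ where $b_N\to1$ as $N\to\infty$. Thus the asymptotic mean capacity becomes $$C^{\mathrm{IPLR}}=\log\left(1+c_p\frac{Q\overline g}{\overline h}N\right)+\mathrm E_0,$$ where $\mathrm E_0=0.5772\ldots$ is the Euler constant, which indicates that the mean capacity of the secondary user scales as $\log(N)$ in the interference power limited regime.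
   Context: Logarithms are natural, $e$ is their base, and $\Gamma(a,b)=\int_b^\infty e^{-t}t^{a-1}\,dt$. The per-antenna SINR of the secondary user is $\gamma=\min\left\{\frac{Qg}{h(P_pq+\sigma^2)},\frac{P_{\max}g}{P_pq+\sigma^2}\right\}$, where $g,h,q$ are independent exponential random variables with means $\overline g,\overline h,\overline q$, and $Q$ (interference power constraint), $P_{\max}$ (maximum transmit power), $P_p$ (primary transmit power), $\sigma^2$ (noise power) are positive. With antenna selection among $N$ antennas, the per-antenna SINRs are treated as i.i.d. with distribution function $F_\gamma$, the rate $R_{\max}$ is the maximum of the $N$ per-antenna rates $\log(1+\gamma)$, and the mean capacity is $\mathbb E[R_{\max}]$. By extreme value theory, the distribution of $R_{\max}$ is approximated for large $N$ by the Gumbel distribution $\exp\left(-e^{-(x-a_N)/b_N}\right)$ with $a_N=\log[1+F_\gamma^{-1}(1-\frac1N)]$ and $b_N=\log\frac{1+F_\gamma^{-1}(1-\frac1{Ne})}{1+F_\gamma^{-1}(1-\frac1N)}$, and the mean capacity is approximated by $a_N+b_N\mathrm E_0$. The asymptotic mean capacity $C^{\mathrm{IPLR}}$ is the value of this approximation when $F_\gamma$ is replaced by the asymptotic $F$ above and $b_N$ by its limit $1$. *)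

(* Defs.v *)
From HB Require Import structures.
From mathcomp Require Import all_boot all_order all_algebra.
From mathcomp Require Import all_classical all_reals all_analysis.
From mathcomp Require Import measurable_realfun.

Set Implicit Arguments.
Unset Strict Implicit.
Unset Printing Implicit Defensive.

Import Order.TTheory GRing.Theory Num.Theory.
Import numFieldNormedType.Exports.

Local Open Scope classical_set_scope.
Local Open Scope ring_scope.

Section probability_notions.
Context {d : measure_display} {T : measurableType d} {R : realType}.
Variable P : probability T R.

(* [exponential_prob] takes the rate, that is, the inverse of the mean [m]. *)
Definition exponential_with_mean (X : {RV P >-> R}) (m : R) : Prop :=
  forall A : set R, measurable A ->
    distribution P X A = exponential_prob m^-1 A.

Definition mutually_independent (I : eqType) (X : I -> {RV P >-> R}) : Prop :=
  forall s : seq I, uniq s ->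
  forall A : I -> set R, (forall i, measurable (A i)) ->
    P (\bigcap_(i in [set` s]) (X i @^-1` A i)) =
    (\prod_(i <- s) P (X i @^-1` A i))%E.

End probability_notions.

Section sinr.
Context {d : measure_display} {T : measurableType d} {R : realType}.
Context {P : probability T R}.
Variables (Q Pp sigma2 : R) (g h q : {RV P >-> R}).

(* The interference power limited regime drops the transmit power constraint,
   the second term of the minimum in [sinr_fun]; it is the limit of [sinr_fun]
   as [Pmax] tends to infinity.  The denominators below vanish only on a null
   set when [h] and [q] are exponential, so that the convention [x / 0 = 0] is
   immaterial. *)
Definition sinr_iplr_fun (t : T) : R :=
  Q * g t / (h t * (Pp * q t + sigma2)).

Definition sinr_fun (Pmax : R) (t : T) : R :=
  Num.min (Q * g t / (h t * (Pp * q t + sigma2)))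
          (Pmax * g t / (Pp * q t + sigma2)).

Let measurable_invr : measurable_fun [set: R] (@GRing.inv R).
Proof.
have m1 : measurable [set (0 : R)] by exact: measurable_set1.
rewrite -(setvU [set (0 : R)]).
apply/measurable_funU => //; first exact: measurableC.
split; last exact: measurable_fun_set1.
apply: open_continuous_measurable_fun.
  by apply: closed_openC; exact: closed_eq.
by move=> x; rewrite inE/= => /eqP; exact: inv_continuous.
Qed.

Let measurable_denom : measurable_fun [set: T] (fun t => Pp * q t + sigma2).
Proof. by apply: measurable_funD => //; exact: measurable_funM. Qed.

Lemma measurable_sinr_iplr_fun : measurable_fun [set: T] sinr_iplr_fun.
Proof.
apply: measurable_funM; first exact: measurable_funM.
by apply: (measurableT_comp measurable_invr); exact: measurable_funM.
Qed.

Lemma measurable_sinr_fun (Pmax : R) :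
  measurable_fun [set: T] (sinr_fun Pmax).
Proof.
apply: measurable_minr; first exact: measurable_sinr_iplr_fun.
apply: measurable_funM; first exact: measurable_funM.
exact: (measurableT_comp measurable_invr).
Qed.

HB.instance Definition _ (Pmax : R) := isMeasurableFun.Build _ _ _ _
  (sinr_fun Pmax) (measurable_sinr_fun Pmax).

HB.instance Definition _ := isMeasurableFun.Build _ _ _ _
  sinr_iplr_fun measurable_sinr_iplr_fun.

Definition sinr (Pmax : R) : {RV P >-> R} := sinr_fun Pmax.

Definition sinr_iplr : {RV P >-> R} := sinr_iplr_fun.

End sinr.

Section antenna_selection.
Context {d : measure_display} {T : measurableType d} {R : realType}.
Variable P : probability T R.

(* The default value 0 of the maximum is harmless for [0 < N], since SINRs,
   hence rates, are almost surely nonnegative. *)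
Definition rate_max (gamma : nat -> {RV P >-> R}) (N : nat) (t : T) : R :=
  \big[Num.max/0]_(i < N) ln (1 + gamma i t).

Definition mean_capacity (gamma : nat -> {RV P >-> R}) (N : nat) : \bar R :=
  ('E_P[rate_max gamma N])%E.

End antenna_selection.

Section gumbel.
Context {R : realType}.

(* Quantile function of a distribution function carried by the positive
   reals; values of [F] outside of ]0, +oo[ are ignored. *)
Definition quantile (F : R -> R) (y : R) : R :=
  inf [set x | 0 < x /\ y <= F x].

Definition gumbel_cdf (a b x : R) : R := expR (- expR (- ((x - a) / b))).

Definition gumbel_a (F : R -> R) (N : nat) : R :=
  ln (1 + quantile F (1 - N%:R^-1)).

Definition gumbel_b (F : R -> R) (N : nat) : R :=
  ln ((1 + quantile F (1 - (N%:R * expR 1)^-1)) /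
      (1 + quantile F (1 - N%:R^-1))).

Definition euler_const : R :=
  limn (fun n : nat => (\sum_(1 <= k < n.+1) k%:R^-1) - ln n%:R).

(* The mean of the Gumbel distribution [gumbel_cdf a b]. *)
Definition gumbel_capacity (a b : R) : R := a + b * euler_const.

Definition asymptotic_capacity (F : R -> R) (N : nat) : R :=
  gumbel_capacity (gumbel_a F N) (limn (gumbel_b F)).

End gumbel.

Section asymptotic_distribution.
Context {R : realType}.

Definition upper_gamma (a b : R) : R :=
  \int[lebesgue_measure]_(t in `[b, +oo[) (expR (- t) * t `^ (a - 1)).

Definition c_p (Pp sigma2 qbar : R) : R :=
  expR (sigma2 / (Pp * qbar)) * upper_gamma 0 (sigma2 / (Pp * qbar)) /
  (Pp * qbar).

(* Meaningful as a distribution function only where it is nonnegative. *)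
Definition F_iplr (Q Pp sigma2 gbar hbar qbar x : R) : R :=
  1 - c_p Pp sigma2 qbar * (Q * gbar / (x * hbar)).

End asymptotic_distribution.

(* Main.v *)
Require Import Defs.
From mathcomp Require Import all_boot all_order all_algebra.
From mathcomp Require Import all_classical all_reals all_analysis.
From HB Require Import structures.
From mathcomp Require Import measurable_realfun ring lra.
Set Implicit Arguments.
Unset Strict Implicit.
Unset Printing Implicit Defensive.
Import Order.TTheory GRing.Theory Num.Theory.
Import numFieldNormedType.Exports.
Local Open Scope classical_set_scope.
Local Open Scope ring_scope.

(** Conditioning on [h] and [q] turns the tail of the SINR into
[P(gamma > x) = E[1 / (1 + x k (Pp q + sigma2))]] with [k = hbar / (Q gbar)].
By dominated convergence [x P(gamma > x)] tends to [E[1 / (Pp q + sigma2)] / k],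
and the substitution [u = (Pp q + sigma2) / (Pp qbar)] identifies this
expectation with [c_p]; the tail is thus equivalent to [L / x] with
[L = c_p Q gbar / hbar], which puts the SINR in the domain of attraction of the
Frechet law and the rate in that of the Gumbel law.

The SINRs without power constraint inherit independence from the constrained
ones, because almost surely the constraint is inactive for large [Pmax]; so the
distribution function of the maximal rate at [z > 0] is [G(e^z - 1)^N].  The
tail bound [P(R_max > ln N + k) <= C e^-k], summed over [k], gives
[E R_max <= ln N + O(1)], and the Gumbel limit with Markov's inequality gives
the matching lower bound. *)

(** * Joint laws and exponential laws *)

Section joint_law.
Local Open Scope ereal_scope.

(** Measurable rectangles are stable under intersection and generate the product sigma-algebra; as
    [m1] is finite, the constant sequence [setT] serves as exhaustion. *)
Lemma finite_measure_prod_unique d1 d2 (T1 : measurableType d1)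
    (T2 : measurableType d2) (R : realType)
    (m1 m2 : {measure set (T1 * T2) -> \bar R}) :
    m1 setT < +oo ->
    (forall A B, measurable A -> measurable B ->
      m1 (A `*` B) = m2 (A `*` B)) ->
  forall X, measurable X -> m1 X = m2 X.
Proof.
move=> m1T m12 X mX.
pose C : set (set (T1 * T2)) :=
  [set C | exists A, measurable A /\ exists B, measurable B /\ C = A `*` B].
apply: (measure_unique C (fun=> setT)) => //.
- rewrite measurable_prod_measurableType //; congr (<<s _ >>).
  rewrite predeqE; split => [[A mA [B mB <-]]|[A [mA [B [mB ->]]]]].
    by exists A; split => //; exists B.
  by exists A => //; exists B.
- move=> /= _ _ [X1 [mX1 [X2 [mX2 ->]]]] [Y1 [mY1 [Y2 [mY2 ->]]]].
  rewrite -setXI; exists (X1 `&` Y1); split; first exact: measurableI.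
  by exists (X2 `&` Y2); split => //; exact: measurableI.
- move=> _; exists setT; split => //; exists setT; split => //.
  by rewrite setXTT.
- by apply/seteqP; split => // x _; exists 0%N.
- by move=> _ [A [mA [B [mB ->]]]]; exact: m12.
Qed.

End joint_law.

Section rv_pair.
Context d d1 d2 (T : measurableType d) (T1 : measurableType d1)
  (T2 : measurableType d2) (R : realType) (P : probability T R).
Variables (X : {RV P >-> T1}) (Y : {RV P >-> T2}).

Definition rv_pair (t : T) : T1 * T2 := (X t, Y t).

Lemma measurable_rv_pair : measurable_fun [set: T] rv_pair.
Proof. by apply: measurable_fun_pair; exact: measurable_funP. Qed.

HB.instance Definition _ := isMeasurableFun.Build _ _ _ _
  rv_pair measurable_rv_pair.

End rv_pair.

Section law_on_event.
Local Open Scope ereal_scope.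
Context d d1 (T : measurableType d) (T1 : measurableType d1) (R : realType)
  (P : probability T R) (A : set T) (mA : measurable A) (X : {RV P >-> T1}).

(** The law of [X] on the event [A], left unnormalized so that a null [A] needs no special case. *)
Definition law_on_event (B : set T1) := mrestr P mA (X @^-1` B).

Let law_on_event0 : law_on_event set0 = 0.
Proof. by rewrite /law_on_event preimage_set0 measure0. Qed.

Let law_on_event_ge0 B : 0 <= law_on_event B.
Proof. exact: measure_ge0. Qed.

Let law_on_event_sigma_additive : semi_sigma_additive law_on_event.
Proof.
move=> F mF tF mUF; rewrite /law_on_event preimage_bigcup.
apply: measure_semi_sigma_additive.
- by move=> n; exact: measurable_funPTI.
- apply/trivIsetP => /= i j _ _ ij; rewrite -preimage_setI.
  by move/trivIsetP : tF => /(_ _ _ _ _ ij) ->//; rewrite preimage_set0.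
- by rewrite -preimage_bigcup; exact: measurable_funPTI.
Qed.

HB.instance Definition _ := isMeasure.Build _ _ _
  law_on_event law_on_event0 law_on_event_ge0 law_on_event_sigma_additive.

End law_on_event.

Section independence_joint_law.
Local Open Scope ereal_scope.
Context d d1 d2 (T : measurableType d) (T1 : measurableType d1)
  (T2 : measurableType d2) (R : realType) (P : probability T R).

Lemma joint_law_prod (X : {RV P >-> T1}) (Y : {RV P >-> T2}) :
    (forall A B, measurable A -> measurable B ->
      P (X @^-1` A `&` Y @^-1` B) = P (X @^-1` A) * P (Y @^-1` B)) ->
  forall D, measurable D -> distribution P (rv_pair X Y) D =
    (distribution P X \x distribution P Y) D.
Proof.
move=> XY D mD; by apply/esym; apply: product_measure_unique.
Qed.

(** For fixed [A], both sides are finite measures in [D], and they agree on rectangles by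
    hypothesis. *)
Lemma indep_pair d3 (T3 : measurableType d3)
    (X : {RV P >-> T1}) (Y : {RV P >-> T2}) (Z : {RV P >-> T3}) :
    (forall A B C, measurable A -> measurable B -> measurable C ->
      P (X @^-1` A `&` (Y @^-1` B `&` Z @^-1` C)) =
      P (X @^-1` A) * P (Y @^-1` B `&` Z @^-1` C)) ->
  forall A D, measurable A -> measurable D ->
    P (X @^-1` A `&` rv_pair Y Z @^-1` D) =
    P (X @^-1` A) * P (rv_pair Y Z @^-1` D).
Proof.
move=> XYZ A D mA mD.
have mXA : measurable (X @^-1` A) by exact: measurable_funPTI.
have PXA0 : (0 <= fine (P (X @^-1` A)))%R by exact: fine_ge0.
have PXAE : P (X @^-1` A) = (fine (P (X @^-1` A)))%:E.
  by rewrite fineK// fin_num_measure.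
rewrite setIC PXAE.
apply: (@finite_measure_prod_unique _ _ _ _ _ (law_on_event mXA (rv_pair Y Z))
  (mscale (NngNum PXA0) (distribution P (rv_pair Y Z)))) => //.
- rewrite /law_on_event /= /mrestr; apply: (le_lt_trans (probability_le1 _ _)).
    by apply: measurableI => //; exact: measurable_funPTI.
  exact: ltry.
- move=> B C mB mC; rewrite /= /law_on_event /mrestr /mscale/= -PXAE setIC.
  exact: XYZ.
Qed.

End independence_joint_law.

Section density.
Local Open Scope ereal_scope.
Context d (T : measurableType d) (R : realType).
Variables (nu : {finite_measure set T -> \bar R})
  (mu : {sigma_finite_measure set T -> \bar R}).

(** The density [p] agrees almost everywhere with the Radon-Nikodym derivative of [nu], for which
    the change of variables is known. *)
Lemma ge0_integral_density (p : T -> R) (f : T -> \bar R) :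
    measurable_fun [set: T] p -> (forall x, (0 <= p x)%R) ->
    (forall A, measurable A -> nu A = \int[mu]_(x in A) (p x)%:E) ->
    measurable_fun [set: T] f -> (forall x, 0 <= f x) ->
  \int[nu]_x f x = \int[mu]_x (f x * (p x)%:E).
Proof.
move=> mp p0 nup mf f0.
have mpE : measurable_fun [set: T] (EFin \o p) by exact/measurable_EFinP.
have numu : nu `<< mu.
  apply/null_content_dominatesP => A mA muA0; rewrite nup//.
  by apply: null_set_integral => //; exact: measurable_funTS.
rewrite -(Radon_Nikodym_SigmaFinite.change_of_variables numu)//.
have RNi := Radon_Nikodym_SigmaFinite.f_integrable numu.
apply: ae_eq_integral => //.
- by apply: emeasurable_funM => //; exact: measurable_int RNi.
- exact: emeasurable_funM.
- apply: ae_eqe_mul2l; apply: integral_ae_eq => // A _ mA.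
  by rewrite -Radon_Nikodym_SigmaFinite.f_integral// nup.
Qed.

End density.

Section exponential_law.
Local Open Scope ereal_scope.
Context d (T : measurableType d) (R : realType) (P : probability T R).
Implicit Types (r m : R) (X : {RV P >-> R}).

Lemma exponential_prob_itvNyc r y :
  exponential_prob r `]-oo, y] = \int[lebesgue_measure]_(x in `[0%R, y])
    (exponential_pdf r x)%:E.
Proof.
rewrite /exponential_prob integral_mkcond [RHS]integral_mkcond.
apply: eq_integral => x _; rewrite !patchE.
have [x0|x0] := ltP (x : R) 0%R.
  by rewrite lt0_exponential_pdf//; case: ifPn => _; case: ifPn.
have -> // : (x \in `]-oo, y]%classic) = (x \in `[0%R, y]%classic).
by apply/idP/idP; rewrite !inE/= !in_itv/= x0.
Qed.

Lemma exponential_law_le X m y : (0 < m)%R -> exponential_with_mean X m ->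
  (0 <= y)%R -> distribution P X `]-oo, y] = (1 - expR (- (y / m)))%:E.
Proof.
(* At [y = 0] the interval is a single point, hence null; the closed form applies to [y > 0]. *)
move=> m0 Xm; rewrite le_eqVlt => /predU1P[<-|y0]; rewrite Xm//.
  rewrite exponential_prob_itvNyc set_itv1 integral_set1.
  by rewrite mul0r oppr0 expR0 subrr.
rewrite exponential_prob_itvNyc -/(exponential_prob m^-1 `[0%R, y]).
by rewrite exponential_prob_itv0c// EFinB mulNr mulrC.
Qed.

Lemma exponential_law_gt X m y : (0 < m)%R -> exponential_with_mean X m ->
  (0 <= y)%R -> distribution P X `]y, +oo[ = (expR (- (y / m)))%:E.
Proof.
move=> m0 Xm y0.
transitivity (1 - distribution P X `]-oo, y]).
  by rewrite -setCitvl probability_setC.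
by rewrite (exponential_law_le m0 Xm y0) -EFinB subKr.
Qed.

Lemma exponential_gt0 X m : (0 < m)%R -> exponential_with_mean X m ->
  {ae P, forall t, (0 < X t)%R}.
Proof.
move=> m0 Xm; exists (X @^-1` `]-oo, 0%R]); split.
- exact: measurable_funPTI.
- have := exponential_law_le m0 Xm (lexx 0%R).
  by rewrite mul0r oppr0 expR0 subrr.
- by move=> t /= /negP; rewrite -leNgt in_itv/=.
Qed.

Lemma integral_exponential_law X m (f : R -> \bar R) : (0 < m)%R ->
    exponential_with_mean X m -> measurable_fun [set: R] f ->
    (forall x, 0 <= f x) ->
  \int[distribution P X]_x f x =
  \int[lebesgue_measure]_x (f x * (exponential_pdf m^-1 x)%:E).
Proof.
move=> m0 Xm mf f0; rewrite ge0_integral_distribution//.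
(* [lebesgue_measure] lives on [measurableTypeR R], whose display differs from
   that of [R], hence the detour through a retyped copy of [X]. *)
have mX : measurable_fun [set: T] (X : T -> measurableTypeR R).
  by move=> _ A mA; exact: (@measurable_funP _ _ _ _ setT X measurableT A mA).
pose X' : {mfun T >-> measurableTypeR R} :=
  HB.pack (X : T -> measurableTypeR R) (isMeasurableFun.Build _ _ _ _ _ mX).
rewrite -(@ge0_integral_distribution _ _ _ _ _ P X')//.
apply: (@ge0_integral_density _ (measurableTypeR R) R (distribution P X')
  lebesgue_measure) => //; first exact: measurable_exponential_pdf.
by move=> x; rewrite exponential_pdf_ge0// invr_ge0 ltW.
Qed.

(** Tilting: [expR (- (s * x))] times the density of rate [m^-1] is [(1 + s * m)^-1] times the
    density of rate [m^-1 + s], whose integral is 1. *)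
Lemma exponential_laplace m s : (0 < m)%R -> (0 <= s)%R ->
  \int[lebesgue_measure]_x
    ((expR (- (s * x)))%:E * (exponential_pdf m^-1 x)%:E) =
  ((1 + s * m)^-1)%:E.
Proof.
move=> m0 s0; have r0 : (0 < m^-1 + s)%R by rewrite ltr_wpDr// invr_gt0.
have sm0 : (0 < 1 + s * m)%R by rewrite ltr_wpDr// mulr_ge0// ltW.
transitivity (((1 + s * m)^-1)%:E *
    \int[lebesgue_measure]_x (exponential_pdf (m^-1 + s) x)%:E).
  rewrite -ge0_integralZl//=; last 3 first.
  - by apply/measurable_EFinP; exact: measurable_exponential_pdf.
  - by move=> x _; rewrite lee_fin exponential_pdf_ge0// ltW.
  - by rewrite lee_fin invr_ge0 ltW.
  apply: eq_integral => x _; rewrite -!EFinM.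
  have [x0|x0] := ltP x 0%R; first by rewrite !lt0_exponential_pdf// !mulr0.
  rewrite !exponential_pdfE// mulrCA -expRD; congr EFin.
  rewrite mulrA; congr (_ * expR _)%R; last by ring.
  by field; rewrite !gt_eqF.
by rewrite integral_exponential_pdf// mule1.
Qed.

End exponential_law.

(** * The tail of the SINR *)

Lemma measurable_lt_set d (T : measurableType d) (R : realType) (f g : T -> R) :
  measurable_fun [set: T] f -> measurable_fun [set: T] g ->
  measurable [set t | f t < g t].
Proof.
move=> mf mg; rewrite -[X in measurable X]setTI.
exact: (measurable_fun_ltr mf mg measurableT (Y := [set true])).
Qed.

Section sinr_tail.
Local Open Scope ereal_scope.
Context d (T : measurableType d) (R : realType) (P : probability T R).

Lemma mutually_independent3 (X Y Z : {RV P >-> R}) :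
    mutually_independent (tnth [tuple X; Y; Z]) ->
  forall A B C, measurable A -> measurable B -> measurable C ->
    P (X @^-1` A `&` (Y @^-1` B `&` Z @^-1` C)) =
    P (X @^-1` A) * (P (Y @^-1` B) * P (Z @^-1` C)).
Proof.
move=> XYZ A B C mA mB mC.
pose i0 : 'I_3 := @Ordinal 3 0 isT; pose i1 : 'I_3 := @Ordinal 3 1 isT.
pose i2 : 'I_3 := @Ordinal 3 2 isT.
have := XYZ [:: i0; i1; i2] isT (tnth [tuple A; B; C]).
rewrite !big_cons big_nil mule1 => <-; last first.
  by move=> -[[|[|[|//]]] ?].
congr (P _); apply/seteqP; split=> [t [At [Bt Ct]] [[|[|[|//]]] ?] _ //|t H].
split; first exact: (H i0).
by split; [exact: (H i1)|exact: (H i2)].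
Qed.

Lemma ae_eq_measure (A B : set T) : measurable A -> measurable B ->
  {ae P, forall t, A t <-> B t} -> P A = P B.
Proof.
move=> mA mB AB; rewrite -(setIT A) -(setIT B) -!integral_indic//.
apply: ae_eq_integral => //.
- exact/measurable_EFinP.
- exact/measurable_EFinP.
- apply: filterS AB => t ABt _; congr EFin; rewrite !indicE.
  suff -> : (t \in A) = (t \in B) by [].
  by apply/idP/idP; rewrite !inE => /ABt.
Qed.

End sinr_tail.

Section sinr_tail_formula.
Local Open Scope ereal_scope.
Context d (T : measurableType d) (R : realType) (P : probability T R).
Variables (Q Pp sigma2 gbar hbar qbar : R) (g h q : {RV P >-> R}).
Hypotheses (Q_gt0 : (0 < Q)%R) (Pp_gt0 : (0 < Pp)%R) (sigma2_gt0 : (0 <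
  sigma2)%R).
Hypotheses (gbar_gt0 : (0 < gbar)%R) (hbar_gt0 : (0 < hbar)%R)
  (qbar_gt0 : (0 < qbar)%R).
Hypotheses (g_exp : exponential_with_mean g gbar)
  (h_exp : exponential_with_mean h hbar) (q_exp : exponential_with_mean q qbar).
Hypothesis ghq : mutually_independent (tnth [tuple g; h; q]).

(** The pair [(h, q)] is put first so that the sections of the tail event are rays for [g], whose
    probability is explicit. *)
Lemma indep_hq_g A D : measurable A -> measurable D ->
  P (rv_pair h q @^-1` D `&` g @^-1` A) =
  P (rv_pair h q @^-1` D) * P (g @^-1` A).
Proof.
move=> mA mD; rewrite setIC muleC.
apply: indep_pair => // B C E mB mC mE.
rewrite (mutually_independent3 ghq)//; congr (_ * _).
have := mutually_independent3 ghq measurableT mC mE.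
by rewrite preimage_setT setTI probability_setT mul1e.
Qed.

Lemma indep_h_q A B : measurable A -> measurable B ->
  P (h @^-1` A `&` q @^-1` B) = P (h @^-1` A) * P (q @^-1` B).
Proof.
move=> mA mB; have := mutually_independent3 ghq measurableT mA mB.
by rewrite preimage_setT setTI probability_setT mul1e.
Qed.

(** The event that the SINR exceeds [x], with the denominator cleared so that no division enters its
    measurability; points are grouped as [((h, q), g)]. *)
Let tail_set (x : R) : set (R * R * R) :=
  [set z | (x * (z.1.1 * (Pp * z.1.2 + sigma2)) < Q * z.2)%R].

Let measurable_tail_set x : measurable (tail_set x).
Proof.
apply: measurable_lt_set => //.
- apply: measurable_funM => //; apply: measurable_funM.
    exact: measurableT_comp.
  apply: measurable_funD => //; apply: measurable_funM => //.
  exact: measurableT_comp.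
- exact: measurable_funM.
Qed.

(** Integrate over [g], then over [h]: at [h = v] and [q = w] the tail of [g] is [expR (- (s * v))]
    with [s = x * (Pp * w + sigma2) / (Q * gbar)], and the Laplace transform of [h] at [s] gives
    [(1 + s * hbar)^-1]. *)
Lemma sinr_tail x : (0 < x)%R ->
  P [set t | (x < sinr_iplr_fun Q Pp sigma2 g h q t)%R] =
  \int[lebesgue_measure]_w (((1 + x * (hbar / (Q * gbar)) *
     (Pp * w + sigma2))^-1)%:E * (exponential_pdf qbar^-1 w)%:E).
Proof.
move=> x0.
transitivity (distribution P (rv_pair (rv_pair h q) g) (tail_set x)).
  (* The denominator can be cleared where [h] and [q] are positive, that is, almost surely. *)
  apply: ae_eq_measure.
  - exact: measurable_lt_set.
  - exact: measurable_funPTI.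
  - have := exponential_gt0 hbar_gt0 h_exp.
    have := exponential_gt0 qbar_gt0 q_exp.
    apply: filterS2 => t qt ht; rewrite /= /tail_set /= /sinr_iplr_fun.
    have S0 : (0 < h t * (Pp * q t + sigma2))%R.
      by rewrite mulr_gt0// addr_gt0// mulr_gt0.
    by rewrite ltr_pdivlMr.
rewrite joint_law_prod//; last by move=> *; exact: indep_hq_g.
rewrite /product_measure1.
(* Independence of [h] and [q] splits their joint law, and Tonelli puts the integral over [q]
   outside. *)
transitivity (\int[distribution P h \x distribution P q]_z
  (distribution P g \o xsection (tail_set x)) z).
  apply: eq_measure_integral => A mA _; apply: joint_law_prod => //.
  exact: indep_h_q.
have mF : measurable_fun setT (distribution P g \o xsection (tail_set x)).
  exact: measurable_fun_xsection.
rewrite fubini_tonelli2//.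
rewrite (integral_exponential_law qbar_gt0 q_exp)//; last 2 first.
- exact: measurable_fun_fubini_tonelli_G.
- by move=> w; exact: integral_ge0.
apply: eq_integral => w _.
have [w0|w0] := ltP (w : R) 0%R.
  by rewrite lt0_exponential_pdf// !mule0.
congr (_ * _).
have S0 : (0 < Pp * w + sigma2)%R by rewrite ltr_wpDl// mulr_ge0// ltW.
rewrite /fubini_G (integral_exponential_law hbar_gt0 h_exp)//; last first.
  exact: measurableT_comp.
have -> : (x * (hbar / (Q * gbar)) * (Pp * w + sigma2) =
    x * (Pp * w + sigma2) / (Q * gbar) * hbar)%R by field; rewrite !gt_eqF.
rewrite -exponential_laplace//; last first.
  by rewrite divr_ge0 ?mulr_ge0// ltW.
apply: eq_integral => v _.
have [v0|v0] := ltP (v : R) 0%R.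
  by rewrite lt0_exponential_pdf// !mule0.
congr (_ * _); rewrite /=.
have -> : xsection (tail_set x) (v, w) =
    `](x * (Pp * w + sigma2) / Q * v)%R, +oo[%classic.
  apply/seteqP; rewrite /tail_set /xsection; split=> u;
    rewrite /= inE /= in_itv/= andbT;
    have -> : (x * (Pp * w + sigma2) / Q * v =
      x * (v * (Pp * w + sigma2)) / Q)%R by ring.
  - by rewrite ltr_pdivrMr// [(u * Q)%R]mulrC.
  - by rewrite ltr_pdivrMr// [(u * Q)%R]mulrC.
rewrite (exponential_law_gt gbar_gt0 g_exp); last first.
  by rewrite mulr_ge0// divr_ge0 ?mulr_ge0// ltW.
by congr (expR (- _))%:E; field; rewrite !gt_eqF.
Qed.

End sinr_tail_formula.

(** * Dominated convergence along a real parameter *)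

Section dominated_convergence_pinfty.
Local Open Scope ereal_scope.
Context d (T : measurableType d) (R : realType).
Variable mu : {measure set T -> \bar R}.

Lemma dominated_cvg_pinfty (f : R -> T -> \bar R) (F G : T -> \bar R) :
    (forall x, (0 < x)%R -> measurable_fun [set: T] (f x)) ->
    measurable_fun [set: T] F ->
    {ae mu, forall t, f x t @[x --> +oo%R] --> F t} ->
    mu.-integrable [set: T] G ->
    (forall x t, (0 < x)%R -> `|f x t| <= G t) ->
  \int[mu]_t f x t @[x --> +oo%R] --> \int[mu]_t F t.
Proof.
move=> mf mF fF iG fG; apply/cvge_pinftyP => u uoo.
(* The hypotheses bear on positive [x] only, so nonpositive terms of [u] are replaced by 1; this
   affects finitely many indices. *)
pose v n := if (0 < u n)%R then u n else 1%R.
have v0 n : (0 < v n)%R by rewrite /v; case: ifPn.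
have uv : \forall n \near \oo, v n = u n.
  have : \forall n \near \oo, (0 < u n)%R by move/cvgryPgt : uoo; exact.
  by apply: filterS => n un0; rewrite /v un0.
have voo : v n @[n --> \oo] --> +oo%R.
  by move: uoo; apply: cvg_trans; apply: near_eq_cvg; apply: filterS uv => n ->.
have [] := @dominated_convergence _ _ _ mu _ measurableT
  (fun n => f (v n)) F G.
- by move=> n; exact: mf.
- by [].
- by apply: filterS fF => t fFt _; exact: (cvg_comp _ _ voo fFt).
- by [].
- by apply: aeW => t n _; exact: fG.
move=> _ _; apply: cvg_trans; apply: near_eq_cvg.
by apply: filterS uv => n /= ->.
Qed.

End dominated_convergence_pinfty.

(** * The constant [c_p] as the mean of the inverse noise *)

Section capacity_constant.
Context {R : realType}.
Notation mu := (@lebesgue_measure R).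
Variables (Pp sigma2 qbar : R).
Hypotheses (Pp_gt0 : 0 < Pp) (sigma2_gt0 : 0 < sigma2) (qbar_gt0 : 0 < qbar).

Let b := sigma2 / (Pp * qbar).

Let b_gt0 : 0 < b. Proof. by rewrite divr_gt0// mulr_gt0. Qed.

Let derive1_affine (x : R) : derive1 (fun w => w / qbar + b) x = qbar^-1.
Proof. by rewrite derive1E derive_val scaler0 add0r addr0 /GRing.scale/= mulr1.
  Qed.

(** Substitution [t = w / qbar + b], which equals [(Pp * w + sigma2) / (Pp * qbar)]. *)
Lemma integral_upper_gamma0 :
  (\int[mu]_(t in `[b, +oo[) (expR (- t) * t `^ (0 - 1))%:E =
   \int[mu]_(w in `[0%R, +oo[) (expR (- (w / qbar + b)) / (w / qbar + b) /
     qbar)%:E)%E.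
Proof.
pose F w := w / qbar + b.
have dF : derive1 F = cst qbar^-1 by apply/funext => y; exact: derive1_affine.
have F0 : F 0 = b by rewrite /F mul0r add0r.
transitivity (\int[mu]_(t in `[F 0%R, +oo[) (expR (- t) / t)%:E)%E.
  rewrite F0; apply: eq_integral => t; rewrite inE/= in_itv/= andbT => bt.
  by rewrite sub0r powR_inv1// (le_trans (ltW b_gt0)).
rewrite increasing_ge0_integration_by_substitutiony.
- apply: eq_integral => w _; by rewrite dF.
- move=> x y _ _ xy; rewrite /F ltrD2r ltr_pM2r// invr_gt0//.
- move=> x _; rewrite dF.
  exact: cvg_cst.
- rewrite dF.
  exact: is_cvg_cst.
- rewrite dF.
  exact: is_cvg_cst.
- split.
    by move=> x _; exact: ex_derive.
  apply: cvg_at_right_filter.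
  by apply: cvgD; [apply: cvgM => //; exact: cvg_cst|exact: cvg_cst].
- apply/cvgryPge => A; apply: filterS (nbhs_pinfty_ge (num_real ((A - b) *
    qbar))).
  by move=> x; rewrite /F -lerBlDr ler_pdivlMr.
- rewrite F0; apply: continuous_in_subspaceT => t.
  rewrite inE/= in_itv/= andbT => bt.
  have t0 : t != 0 by rewrite gt_eqF// (lt_le_trans b_gt0).
  apply: cvgM; last exact: inv_continuous.
  by apply: continuous_comp; [exact: cvgN|exact: continuous_expR].
- move=> t; rewrite in_itv/= andbT F0 => bt.
  by rewrite divr_ge0 ?expR_ge0// ltW// (lt_trans b_gt0).
Qed.
End capacity_constant.

Lemma measurable_invr (R : realType) : measurable_fun [set: R] (@GRing.inv R).
Proof.
(* The identity holds at 0 too, where both sides are 0, and reduces inversion to a power function of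
   a nonnegative argument. *)
have -> : @GRing.inv R = (fun x => x * (x ^+ 2) `^ (-1)).
  apply/funext => x; rewrite powR_inv1 ?sqr_ge0//.
  have [->|x0] := eqVneq x 0; first by rewrite invr0 mul0r.
  by rewrite expr2 invfM mulrA mulfV// mul1r.
apply: measurable_funM => //.
by apply: (measurableT_comp (measurable_powR (-1))); exact: measurable_funX.
Qed.

Section noise_integral.
Context {R : realType}.
Notation mu := (@lebesgue_measure R).
Variables (Pp sigma2 qbar : R).
Hypotheses (Pp_gt0 : 0 < Pp) (sigma2_gt0 : 0 < sigma2) (qbar_gt0 : 0 < qbar).

Let p := exponential_pdf qbar^-1.

Let p_ge0 w : 0 <= p w.
Proof. by rewrite exponential_pdf_ge0// invr_ge0 ltW. Qed.

Let mp : measurable_fun [set: R] p.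
Proof. exact: measurable_exponential_pdf. Qed.

Lemma noise_ge w : 0 <= w -> sigma2 <= Pp * w + sigma2.
Proof. by move=> w0; rewrite lerDr mulr_ge0// ltW. Qed.

Let noise_gt0 w : 0 <= w -> 0 < Pp * w + sigma2.
Proof. by move=> w0; rewrite (lt_le_trans sigma2_gt0)// noise_ge. Qed.

Lemma measurable_noise_weight (f : R -> R) : measurable_fun [set: R] f ->
  measurable_fun [set: R] (fun w => ((f w)^-1)%:E * (p w)%:E)%E.
Proof.
move=> mf; apply: emeasurable_funM; apply/measurable_EFinP => //.
exact: (measurableT_comp (@measurable_invr R) mf).
Qed.

Let mS : measurable_fun [set: R] (fun w => Pp * w + sigma2).
Proof. by apply: measurable_funD => //; exact: measurable_funM. Qed.

Lemma noise_integral_ge0 :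
  (0 <= \int[mu]_w (((Pp * w + sigma2)^-1)%:E * (p w)%:E))%E.
Proof.
apply: integral_ge0 => w _; rewrite -EFinM lee_fin.
have [w0|w0] := ltP (w : R) 0; first by rewrite /p lt0_exponential_pdf// mulr0.
by rewrite mulr_ge0// invr_ge0 ltW// noise_gt0.
Qed.

(** The weight [p] is a probability density vanishing on negative reals, so a bound on the
    nonnegative half-line passes to the average. *)
Lemma integral_exponential_weight_le (f : R -> R) (M : R) :
  measurable_fun [set: R] f ->
  (forall w, 0 <= w -> 0 < f w) -> (forall w, 0 <= w -> (f w)^-1 <= M) ->
  (\int[mu]_w (((f w)^-1)%:E * (p w)%:E) <= M%:E)%E.
Proof.
move=> mf f0 fM; have M0 : 0 <= M.
  by rewrite (le_trans _ (fM 0 (lexx _)))// invr_ge0 ltW// f0.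
rewrite -[leRHS]mule1 -(integral_exponential_pdf (rate := qbar^-1)) ?invr_gt0//.
rewrite -ge0_integralZl//=; last 2 first.
- by apply/measurable_EFinP; exact: measurable_exponential_pdf.
- by move=> w _; rewrite lee_fin p_ge0.
apply: ge0_le_integral => //=.
- move=> w _; rewrite -EFinM lee_fin.
  have [w0|w0] := ltP (w : R) 0;
    first by rewrite /p lt0_exponential_pdf// mulr0.
  by rewrite mulr_ge0// invr_ge0 ltW// f0.
- exact: measurable_noise_weight.
- by apply: emeasurable_funM => //; apply/measurable_EFinP.
- move=> w _; rewrite -!EFinM lee_fin.
  have [w0|w0] := ltP (w : R) 0.
    by rewrite /p lt0_exponential_pdf// !mulr0.
  by rewrite ler_wpM2r ?p_ge0// fM.
Qed.

(** The substitution expresses the incomplete gamma integral as this mean times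
    [expR (- b) * (Pp * qbar)], a factor that the prefactor of [c_p] cancels. *)
Lemma noise_integralE :
  (\int[mu]_w (((Pp * w + sigma2)^-1)%:E * (p w)%:E))%E = (c_p Pp sigma2
    qbar)%:E.
Proof.
set K := integral _ _ _; pose b := sigma2 / (Pp * qbar).
(* [upper_gamma] is real-valued, obtained through [fine], so [K] must be finite before the product
   can be split. *)
have Kfin : K \is a fin_num.
  rewrite ge0_fin_numE ?noise_integral_ge0//.
  apply: (@le_lt_trans _ _ (sigma2^-1)%:E); last exact: ltry.
  apply: integral_exponential_weight_le => // w w0.
  by rewrite lef_pV2 ?posrE ?noise_gt0// noise_ge.
have PQ0 : Pp * qbar != 0 by rewrite gt_eqF// mulr_gt0.
rewrite -(fineK Kfin); congr EFin.
have cE : (\int[mu]_(t in `[b, +oo[) (expR (- t) * t `^ (0 - 1))%:E =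
    (expR (- b) * (Pp * qbar))%:E * K)%E.
  rewrite integral_upper_gamma0// -ge0_integralZl//=; last 3 first.
  - exact: measurable_noise_weight.
  - move=> w _; rewrite -EFinM lee_fin.
    have [w0|w0] := ltP (w : R) 0;
      first by rewrite /p lt0_exponential_pdf// mulr0.
    by rewrite mulr_ge0// invr_ge0 ltW// noise_gt0.
  - by rewrite lee_fin mulr_ge0 ?expR_ge0// mulr_ge0// ltW.
  rewrite integral_mkcond; apply: eq_integral => w _; rewrite patchE.
  have [w0|w0] := ltP (w : R) 0.
    rewrite /p lt0_exponential_pdf// !mule0; case: ifPn => //.
    by rewrite inE/= in_itv/= andbT leNgt w0.
  rewrite mem_set/= ?in_itv/= ?w0// -!EFinM; congr EFin.
  rewrite /p exponential_pdfE// opprD expRD -/b mulNr.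
  have -> : qbar^-1 * w = w / qbar by rewrite mulrC.
  have := noise_gt0 w0 => S0; move: (expR (- b)) (expR (- (w / qbar))) => x y;
    rewrite /b; field.
  by rewrite !gt_eqF.
rewrite /c_p /upper_gamma /Rintegral -/b cE fineM// /=.
rewrite expRN; field.
by rewrite !gt_eqF// expR_gt0.
Qed.

(** On [[0, 1]] the noise is at most [Pp + sigma2], and the exponential law of mean [qbar] gives
    this interval the mass [1 - expR (- qbar^-1)]. *)
Lemma c_p_gt0 : 0 < c_p Pp sigma2 qbar.
Proof.
rewrite -lte_fin -noise_integralE.
have e1 : 0 < 1 - expR (- (qbar^-1)) by rewrite subr_gt0 expR_lt1 oppr_lt0
  invr_gt0.
apply: (@lt_le_trans _ _ (((Pp + sigma2)^-1 * (1 - expR (- qbar^-1)))%:E)).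
  by rewrite lte_fin mulr_gt0// invr_gt0 addr_gt0.
have := @exponential_prob_itv0c R qbar^-1 1 ltr01; rewrite mulr1 => E.
rewrite EFinM EFinB -E.
rewrite /exponential_prob -ge0_integralZl//=; last 3 first.
- by apply: measurable_funTS; apply/measurable_EFinP.
- by move=> w _; rewrite lee_fin p_ge0.
- by rewrite lee_fin invr_ge0 addr_ge0// ltW.
rewrite integral_mkcond; apply: ge0_le_integral => //=.
- by move=> w _; rewrite patchE; case: ifPn => // _;
    rewrite -EFinM lee_fin mulr_ge0// invr_ge0 addr_ge0// ltW.
- apply/measurable_restrict => //; apply: measurable_funTS.
  by apply: emeasurable_funM => //; apply/measurable_EFinP.
- exact: measurable_noise_weight.
- move=> w _; rewrite patchE; case: ifPn => [|_]; last first.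
    rewrite -EFinM lee_fin.
    have [w0|w0] := ltP (w : R) 0;
      first by rewrite /p lt0_exponential_pdf// mulr0.
    by rewrite mulr_ge0// invr_ge0 ltW// noise_gt0.
  rewrite inE/= in_itv/= => /andP[w0 w1]; rewrite -!EFinM lee_fin ler_wpM2r//.
  by rewrite lef_pV2 ?posrE ?noise_gt0// ?addr_gt0// lerD2r ler_piMr// ltW.
Qed.

End noise_integral.

(** * Decay of the tail integral at infinity *)

Section noise_tail.
Context {R : realType}.
Notation mu := (@lebesgue_measure R).
Variables (Pp sigma2 qbar k : R).
Hypotheses (Pp_gt0 : 0 < Pp) (sigma2_gt0 : 0 < sigma2) (qbar_gt0 : 0 < qbar).
Hypothesis k_gt0 : 0 < k.

Let p := exponential_pdf qbar^-1.

Let p_ge0 w : 0 <= p w.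
Proof. by rewrite exponential_pdf_ge0// invr_ge0 ltW. Qed.

Let mp : measurable_fun [set: R] p.
Proof. exact: measurable_exponential_pdf. Qed.

Let S w := Pp * w + sigma2.

Let S_gt0 w : 0 <= w -> 0 < S w.
Proof. by move=> w0; rewrite (lt_le_trans sigma2_gt0)// noise_ge. Qed.

Let mS : measurable_fun [set: R] S.
Proof. by apply: measurable_funD => //; exact: measurable_funM. Qed.

(** The tail of the SINR without power constraint, for [k = hbar / (Q * gbar)]. *)
Let tail x : \bar R :=
  (\int[mu]_w (((1 + x * k * S w)^-1)%:E * (p w)%:E))%E.

(** Moving [x] inside the inverse leaves [x^-1 + k * S w], which for [w >= 0] is at least
    [k * sigma2] and tends to [k * S w] as [x] grows. *)
Let tail_scale x : 0 < x ->
  (x%:E * tail x = \int[mu]_w (((x^-1 + k * S w)^-1)%:E * (p w)%:E))%E.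
Proof.
move=> x0; rewrite -ge0_integralZl//=; last 3 first.
- apply: measurable_noise_weight; apply: measurable_funD => //.
  exact: measurable_funM.
- move=> w _; rewrite -EFinM lee_fin.
  have [w0|w0] := ltP (w : R) 0;
    first by rewrite /p lt0_exponential_pdf// mulr0.
  by rewrite mulr_ge0// invr_ge0 addr_ge0// !mulr_ge0// ltW// S_gt0.
- by rewrite lee_fin ltW.
apply: eq_integral => w _.
have [w0|w0] := ltP (w : R) 0.
  by rewrite /p lt0_exponential_pdf// !mule0.
rewrite -!EFinM mulrA; congr (_ * _)%:E.
have := S_gt0 w0; move: (S w) => s s0; field.
by rewrite !gt_eqF// addr_gt0// !mulr_gt0.
Qed.

Lemma noise_tail_le x : 0 < x -> (x%:E * tail x <= ((k * sigma2)^-1)%:E)%E.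
Proof.
move=> x0; rewrite tail_scale//; apply: integral_exponential_weight_le => //.
- by apply: measurable_funD => //; exact: measurable_funM.
- by move=> w w0; rewrite addr_gt0 ?invr_gt0// mulr_gt0// S_gt0.
- move=> w w0; rewrite lef_pV2 ?posrE ?mulr_gt0//; last first.
    by rewrite addr_gt0 ?invr_gt0// mulr_gt0// S_gt0.
  by apply: ler_wpDl; [rewrite invr_ge0 ltW|rewrite ler_pM2l// noise_ge].
Qed.

(** Dominated convergence, with [(k * sigma2)^-1] times the density as bound; [noise_integralE]
    evaluates the limit. *)
Lemma noise_tail_cvg :
  (x%:E * tail x)%E @[x --> +oo] --> (c_p Pp sigma2 qbar / k)%:E.
Proof.
have -> : ((c_p Pp sigma2 qbar / k)%:E =
    \int[mu]_w (((k * S w)^-1)%:E * (p w)%:E))%E.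
  rewrite mulrC EFinM -noise_integralE// -ge0_integralZl//=; last 3 first.
  - exact: measurable_noise_weight.
  - move=> w _; rewrite -EFinM lee_fin.
    have [w0|w0] := ltP (w : R) 0;
      first by rewrite /p lt0_exponential_pdf// mulr0.
    by rewrite mulr_ge0// invr_ge0 ltW// S_gt0.
  - by rewrite lee_fin invr_ge0 ltW.
  by apply: eq_integral => w _; rewrite -!EFinM mulrA invfM.
suff : (\int[mu]_w (((x^-1 + k * S w)^-1)%:E * (p w)%:E))%E @[x --> +oo] -->
    (\int[mu]_w (((k * S w)^-1)%:E * (p w)%:E))%E.
  apply: cvg_trans; apply: near_eq_cvg.
  by apply: filterS (nbhs_pinfty_gt (num_real 0)) => x x0; rewrite tail_scale.
apply: (@dominated_cvg_pinfty _ _ _ mu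
  (fun x w => ((x^-1 + k * S w)^-1)%:E * (p w)%:E)%E
  (fun w => ((k * S w)^-1)%:E * (p w)%:E)%E
  (fun w => ((k * sigma2)^-1)%:E * (p w)%:E)%E).
- move=> x _; apply: measurable_noise_weight.
  by apply: measurable_funD => //; exact: measurable_funM.
- by apply: measurable_noise_weight; exact: measurable_funM.
- apply: aeW => w.
  have [w0|w0] := ltP (w : R) 0.
    by rewrite /p lt0_exponential_pdf// mule0; under eq_fun do rewrite mule0;
      exact: cvg_cst.
  under eq_fun do rewrite -EFinM; rewrite -EFinM.
  apply: cvg_EFin; first exact: nearW.
  apply: cvgM; last exact: cvg_cst.
  apply: cvgV; first by rewrite gt_eqF// mulr_gt0// S_gt0.
  rewrite -[X in _ --> X]add0r; apply: cvgD; last exact: cvg_cst.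
  apply/gtr0_cvgV0 => //; exact: nbhs_pinfty_gt.
- apply: integrableZl => //.
  by have /= := @integrable_exponential_pdf R qbar^-1; rewrite invr_gt0; exact.
- move=> x w x0.
  have [w0|w0] := ltP (w : R) 0.
    by rewrite /p lt0_exponential_pdf// !mule0 abse0.
  have xkS : 0 < x^-1 + k * S w.
    by rewrite addr_gt0 ?invr_gt0// mulr_gt0// S_gt0.
  rewrite gee0_abs -!EFinM lee_fin; last by rewrite mulr_ge0// invr_ge0 ltW.
  rewrite ler_wpM2r// lef_pV2 ?posrE ?mulr_gt0//.
  by apply: ler_wpDl; [rewrite invr_ge0 ltW|rewrite ler_pM2l// noise_ge].
Qed.

End noise_tail.

(** * The SINR without power constraint as a limit, and its tail *)

Section sinr_limits.
Local Open Scope ereal_scope.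
Context d (T : measurableType d) (R : realType) (P : probability T R).

(** Almost surely the indicators of [A x] are eventually constant, and they are bounded by 1. *)
Lemma cvg_measure_near (A : R -> set T) (B : set T) :
    (forall x, measurable (A x)) -> measurable B ->
    {ae P, forall t, \forall x \near +oo%R, A x t <-> B t} ->
  P (A x) @[x --> +oo%R] --> P B.
Proof.
move=> mA mB AB.
have PE C : measurable C -> P C = \int[P]_t (\1_C t)%:E.
  by move=> mC; rewrite integral_indic// setIT.
rewrite PE//; under eq_fun do rewrite PE//.
apply: (@dominated_cvg_pinfty _ _ _ P (fun x t => (\1_(A x) t)%:E)
  (fun t => (\1_B t)%:E) (cst 1)) => //.
- by move=> x _; exact/measurable_EFinP.
- exact/measurable_EFinP.
- apply: filterS AB => t ABt; apply: cvg_near_cst.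
  apply: filterS ABt => x xAB; congr EFin; rewrite !indicE.
  suff -> : (t \in A x) = (t \in B) by [].
  by apply/idP/idP; rewrite !inE => /xAB.
- exact: (finite_measure_integrable_cst P 1).
- by move=> x t _; rewrite indicE /=; case: (t \in A x);
    rewrite ?normr1 ?normr0 lee_fin.
Qed.

Variables (Q Pp sigma2 gbar hbar qbar : R) (g h q : {RV P >-> R}).
Hypotheses (Q_gt0 : (0 < Q)%R) (Pp_gt0 : (0 < Pp)%R) (sigma2_gt0 : (0 <
  sigma2)%R).
Hypotheses (gbar_gt0 : (0 < gbar)%R) (hbar_gt0 : (0 < hbar)%R)
  (qbar_gt0 : (0 < qbar)%R).
Hypotheses (g_exp : exponential_with_mean g gbar)
  (h_exp : exponential_with_mean h hbar) (q_exp : exponential_with_mean q qbar).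

Lemma sinr_near_iplr : {ae P, forall t, \forall x \near +oo%R,
  sinr_fun Q Pp sigma2 g h q x t = sinr_iplr_fun Q Pp sigma2 g h q t}.
Proof.
have := exponential_gt0 gbar_gt0 g_exp.
have := exponential_gt0 hbar_gt0 h_exp.
have := exponential_gt0 qbar_gt0 q_exp.
apply: filterS3 => t qt ht gt.
have S0 : (0 < Pp * q t + sigma2)%R by rewrite addr_gt0// mulr_gt0.
(* The first term of the minimum is the smaller one as soon as the power reaches [Q / h t], a
   threshold that depends on [t]. *)
apply: filterS (nbhs_pinfty_ge (num_real (Q / h t))) => x hx.
rewrite /sinr_fun /sinr_iplr_fun; apply/min_idPl.
rewrite ler_pdivrMr ?mulr_gt0//.
have -> : (x * g t / (Pp * q t + sigma2) * (h t * (Pp * q t + sigma2)) =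
  (x * h t) * g t)%R by field; rewrite gt_eqF.
by rewrite ler_pM2r// -ler_pdivrMr.
Qed.

Lemma cdf_sinr_cvg x :
  cdf (sinr Q Pp sigma2 g h q M : {RV P >-> R}) x @[M --> +oo%R] -->
  cdf (sinr_iplr Q Pp sigma2 g h q : {RV P >-> R}) x.
Proof.
apply: cvg_measure_near => [M| |].
- exact: measurable_funPTI.
- exact: measurable_funPTI.
- apply: filterS sinr_near_iplr => t; apply: filterS => M E.
  by rewrite /= /sinr /sinr_iplr E.
Qed.

Hypothesis ghq : mutually_independent (tnth [tuple g; h; q]).
Let gammaI : {RV P >-> R} := sinr_iplr Q Pp sigma2 g h q.

Lemma fine_ccdf (X : {RV P >-> R}) x : (1 - fine (cdf X x))%:E = ccdf X x.
Proof. by rewrite ccdf_1_cdf EFinB fineK// fin_num_measure. Qed.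

Lemma ccdf_sinr_iplr x : (0 < x)%R -> ccdf gammaI x =
  \int[lebesgue_measure]_w (((1 + x * (hbar / (Q * gbar)) *
     (Pp * w + sigma2))^-1)%:E * (exponential_pdf qbar^-1 w)%:E).
Proof.
move=> x0; rewrite -(sinr_tail Q_gt0 Pp_gt0 sigma2_gt0 gbar_gt0 hbar_gt0
  qbar_gt0 g_exp h_exp q_exp ghq x0).
by congr (P _); apply/seteqP; split=> t; rewrite /= in_itv/= andbT.
Qed.

Lemma sinr_iplr_tail_cvg :
  (x * (1 - fine (cdf gammaI x)))%R @[x --> +oo%R] -->
  (c_p Pp sigma2 qbar * (Q * gbar / hbar))%R.
Proof.
have k0 : (0 < hbar / (Q * gbar))%R by rewrite divr_gt0// mulr_gt0.
have -> : (Q * gbar / hbar = (hbar / (Q * gbar))^-1)%R by rewrite invf_div.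
have := noise_tail_cvg Pp_gt0 sigma2_gt0 qbar_gt0 k0 => /fine_cvg.
apply: cvg_trans; apply: near_eq_cvg.
apply: filterS (nbhs_pinfty_gt (num_real 0%R)) => x x0.
by rewrite /= -ccdf_sinr_iplr// -fine_ccdf.
Qed.

Lemma sinr_iplr_tail_le x : (0 < x)%R ->
  (x * (1 - fine (cdf gammaI x)) <= Q * gbar / (hbar * sigma2))%R.
Proof.
have k0 : (0 < hbar / (Q * gbar))%R by rewrite divr_gt0// mulr_gt0.
move=> x0; rewrite -lee_fin EFinM fine_ccdf ccdf_sinr_iplr//.
apply: (le_trans (noise_tail_le Pp_gt0 sigma2_gt0 qbar_gt0 k0 x0)).
by rewrite lee_fin invfM invf_div invfM mulrA.
Qed.

End sinr_limits.

(** Distribution functions are finite, so the product can be taken in the reals, where limits pass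
    through products. *)
Lemma prod_cdfE d (T : measurableType d) (R : realType) (P : probability T R)
    (X : nat -> {RV P >-> R}) N y :
  (\prod_(i < N) cdf (X i) y = (\prod_(i < N) fine (cdf (X i) y))%:E)%E.
Proof.
elim: N => [|N IH]; first by rewrite !big_ord0.
by rewrite !big_ord_recr/= IH EFinM fineK// fin_num_measure.
Qed.

Section sinr_independence.
Local Open Scope ereal_scope.
Context d (T : measurableType d) (R : realType) (P : probability T R).
Variables (Q Pp sigma2 gbar hbar qbar : R) (g h q : nat -> {RV P >-> R}).
Hypotheses (Pp_gt0 : (0 < Pp)%R) (sigma2_gt0 : (0 < sigma2)%R).
Hypotheses (gbar_gt0 : (0 < gbar)%R) (hbar_gt0 : (0 < hbar)%R)
  (qbar_gt0 : (0 < qbar)%R).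
Hypotheses (g_exp : forall i, exponential_with_mean (g i) gbar)
  (h_exp : forall i, exponential_with_mean (h i) hbar)
  (q_exp : forall i, exponential_with_mean (q i) qbar).
Hypothesis sinr_indep : forall Pmax : R, (0 < Pmax)%R ->
     mutually_independent (fun i => sinr Q Pp sigma2 (g i) (h i) (q i) Pmax).

Let gammaI (i : nat) : {RV P >-> R} := sinr_iplr Q Pp sigma2 (g i) (h i) (q i).

(** The threshold depends on the antenna; [N] being finite, the thresholds and null sets combine by
    induction. *)
Lemma all_sinr_near_iplr N : {ae P, forall t, \forall x \near +oo%R,
  forall i, (i < N)%N -> sinr_fun Q Pp sigma2 (g i) (h i) (q i) x t =
    sinr_iplr_fun Q Pp sigma2 (g i) (h i) (q i) t}.
Proof.
elim: N => [|N IH]; first by apply: aeW => t; exact: nearW.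
have := sinr_near_iplr Q Pp_gt0 sigma2_gt0 gbar_gt0 hbar_gt0 qbar_gt0
  (g_exp N) (h_exp N) (q_exp N).
apply: filterS2 IH => t IHt; apply: filterS2 IHt => x IHx EN i.
by rewrite ltnS leq_eqVlt => /predU1P[->//|]; exact: IHx.
Qed.

(** The probability of the constrained event has two limits as [M] grows: the left side, since
    almost surely the event is eventually constant, and the right side, by independence and
    convergence of each factor. Limits are unique. *)
Lemma sinr_iplr_indep_rays N y :
  P [set t | forall i, (i < N)%N -> (gammaI i t <= y)%R] =
  \prod_(i < N) cdf (gammaI i) y.
Proof.
pose A (X : nat -> {RV P >-> R}) := \bigcap_(i in [set` iota 0 N]) (X i @^-1`
  `]-oo, y]).
have AE X : A X = [set t | forall i, (i < N)%N -> (X i t <= y)%R].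
  apply/seteqP; split=> t H i iN.
    by have := H i; rewrite /= mem_iota in_itv/=; exact.
  by rewrite /= in_itv/= H//; move: iN; rewrite /= mem_iota.
have mA X : measurable (A X).
  by apply: bigcap_measurableType => i _; exact: measurable_funPTI.
pose gam M i : {RV P >-> R} := sinr Q Pp sigma2 (g i) (h i) (q i) M.
have c1 : P (A (gam M)) @[M --> +oo%R] --> P (A gammaI).
  apply: cvg_measure_near => //.
  apply: filterS (all_sinr_near_iplr N) => t; apply: filterS => M E.
  rewrite !AE /=; split=> H i iN.
    by rewrite /gammaI /sinr_iplr -E//; exact: H.
  by rewrite /gam /sinr E//; exact: H.
have PAE M : (0 < M)%R -> P (A (gam M)) = \prod_(i < N) cdf (gam M i) y.
  move=> M0; rewrite -(big_mkord xpredT (fun i => cdf (gam M i) y)).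
  rewrite /index_iota subn0.
  exact: (sinr_indep M0 (iota_uniq 0 N) (A := fun=> `]-oo, y]%classic)).
have c2 : P (A (gam M)) @[M --> +oo%R] --> \prod_(i < N) cdf (gammaI i) y.
  rewrite prod_cdfE.
  suff : (\prod_(i < N) fine (cdf (gam M i) y))%:E @[M --> +oo%R] -->
      (\prod_(i < N) fine (cdf (gammaI i) y))%:E.
    apply: cvg_trans; apply: near_eq_cvg.
    apply: filterS (nbhs_pinfty_gt (num_real 0%R)) => M M0.
    by rewrite PAE// prod_cdfE.
  apply: cvg_EFin; first exact: nearW.
  suff H n : (\prod_(i < n) fine (cdf (gam M i) y))%R @[M --> +oo%R] -->
      (\prod_(i < n) fine (cdf (gammaI i) y))%R by exact: H.
  elim: n => [|n IHn].
    by rewrite big_ord0; under eq_fun do rewrite big_ord0; exact: cvg_cst.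
  rewrite big_ord_recr; under eq_fun do rewrite big_ord_recr.
  apply: cvgM => //; apply: fine_cvg; rewrite fineK ?fin_num_measure//.
  exact: (cdf_sinr_cvg Pp_gt0 sigma2_gt0 gbar_gt0 hbar_gt0 qbar_gt0).
by rewrite -AE; exact: (cvg_unique _ c1 c2).
Qed.

End sinr_independence.

(** * Maxima of independent rates *)

Section elementary_limits.
Context {R : realType}.
Implicit Types (u c : nat -> R) (L tau : R).

Lemma cvgn_natr_inv : (n%:R^-1 : R) @[n --> \oo] --> (0 : R).
Proof.
apply/gtr0_cvgV0; last exact: cvgr_idn.
by exists 1%N => // n /= n1; rewrite ltr0n.
Qed.

(** The Poisson limit: if each of [n] independent SINRs exceeds a level with probability [u n], the
    maximum stays below it with probability [(1 - u n) ^+ n]. *)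
Lemma cvg_pow_expR u tau : (forall n, 0 <= u n <= 1) ->
  n%:R * u n @[n --> \oo] --> tau ->
  (1 - u n) ^+ n @[n --> \oo] --> expR (- tau).
Proof.
move=> u01 nu.
have u0 : u n @[n --> \oo] --> (0 : R).
  rewrite -(mulr0 tau).
  have H : n%:R * u n * n%:R^-1 @[n --> \oo] --> tau * 0.
    by apply: cvgM => //; exact: cvgn_natr_inv.
  apply: cvg_trans H; apply: near_eq_cvg; exists 1%N => // n /= n1.
  by rewrite mulrAC mulfV ?mul1r// pnatr_eq0 -lt0n.
have u1 : 1 - u n @[n --> \oo] --> (1 : R).
  by rewrite -[X in _ --> X]subr0; apply: cvgB => //; exact: cvg_cst.
(* [expR (- (u / (1 - u))) <= 1 - u <= expR (- u)] *)
apply: (@squeeze_cvgr _ _ _ _ (fun n => expR (- (n%:R * u n / (1 - u n))))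
  (fun n => expR (- (n%:R * u n)))).
- have : \forall n \near \oo, 0 < 1 - u n by move/cvgr_gt : u1; apply.
  apply: filterS => n v0; have /andP[un0 _] := u01 n.
  rewrite -mulrA -(mulrN n%:R (u n / _)) -(mulrN n%:R (u n)) !expRM_natl;
    apply/andP; split; apply: lerXn2r.
  - by rewrite nnegrE expR_ge0.
  - by rewrite nnegrE ltW.
  - rewrite expRN -[leRHS]invrK lef_pV2 ?posrE ?invr_gt0 ?expR_gt0//.
    apply: le_trans (expR_ge1Dx _).
    have -> // : 1 + u n / (1 - u n) = (1 - u n)^-1 by field; rewrite gt_eqF.
  - by rewrite nnegrE ltW.
  - by rewrite nnegrE expR_ge0.
  - exact: expR_ge1Dx.
- apply: continuous_cvg; first exact: continuous_expR.
  apply: cvgN; rewrite -[X in _ --> X]divr1; apply: cvgM => //.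
  exact: cvgV.
- by apply: continuous_cvg; [exact: continuous_expR|exact: cvgN].
Qed.

Lemma cvg_lnn : ln (n%:R : R) @[n --> \oo] --> +oo.
Proof.
apply/cvgryPge => A; have := @cvgr_idn R => /cvgryPge/(_ (expR A)).
apply: filterS => n An; rewrite -ler_expR lnK// posrE.
exact: lt_le_trans (expR_gt0 _) An.
Qed.

(** [ln (1 + L * n)] is [ln n] plus [ln (n^-1 + L)], which converges. *)
Lemma cvg_ln_ratio L c tau : 0 < L -> c n @[n --> \oo] --> tau ->
  (ln (1 + L * n%:R) + c n) / ln n%:R @[n --> \oo] --> (1 : R).
Proof.
move=> L0 ctau.
have lnV0 : (ln (n%:R : R))^-1 @[n --> \oo] --> (0 : R).
  apply/gtr0_cvgV0; last exact: cvg_lnn.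
  by move/cvgryPgt : cvg_lnn; exact.
have H : 1 + (ln (n%:R^-1 + L) + c n) / ln n%:R @[n --> \oo] --> (1 : R).
  rewrite -[X in _ --> X]addr0; apply: cvgD; first exact: cvg_cst.
  rewrite -(mulr0 (ln (0 + L) + tau)); apply: cvgM => //.
  apply: cvgD => //; apply: continuous_cvg.
    by apply: continuous_ln; rewrite add0r.
  by apply: cvgD; [exact: cvgn_natr_inv|exact: cvg_cst].
apply: cvg_trans H; apply: near_eq_cvg; exists 2%N => // n /= n2.
have n0 : 0 < (n%:R : R) by rewrite ltr0n (leq_trans _ n2).
have ln0 : 0 < ln (n%:R : R) by rewrite ln_gt0// ltr1n.
have -> : 1 + L * n%:R = n%:R * (n%:R^-1 + L).
  by rewrite mulrDr mulfV ?gt_eqF// [L * _]mulrC.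
rewrite lnM ?posrE//; last by rewrite addr_gt0 ?invr_gt0.
by rewrite -addrA [in RHS]mulrDl mulfV// gt_eqF.
Qed.

End elementary_limits.

Section rate_max_theory.
Local Open Scope ereal_scope.
Context d (T : measurableType d) (R : realType) (P : probability T R).
Implicit Types gamma : nat -> {RV P >-> R}.

Lemma rate_max_ge0 gamma N t : (0 <= rate_max gamma N t)%R.
Proof. exact: bigmax_ge_id. Qed.

Lemma measurable_rate_max gamma N : measurable_fun [set: T] (rate_max gamma N).
Proof.
rewrite /rate_max; elim: N gamma => [|N IH] gamma.
  by under eq_fun do rewrite big_ord0; exact: measurable_cst.
under eq_fun do rewrite big_ord_recl.
apply: measurable_maxr; last exact: (IH (fun i => gamma i.+1)).
by apply: (measurableT_comp (@measurable_ln R)); exact: measurable_funD.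
Qed.

Lemma ln1D_le (a z : R) : (0 <= z)%R -> (ln (1 + a) <= z)%R = (a <= expR z -
  1)%R.
Proof.
move=> z0; have [a0|a0] := ltP 0%R (1 + a)%R.
  by rewrite -ler_expR lnK// lerBrDl.
(* Here [ln] takes its default value 0: the left side holds since [0 <= z], the right side since
   [a <= -1]. *)
rewrite ln0// z0; apply/esym/idP.
have := expR_ge0 z; lra.
Qed.

(** Nonnegativity of [z] absorbs both the default value 0 of the maximum and that of [ln]. *)
Lemma rate_max_le gamma N t z : (0 <= z)%R ->
  (rate_max gamma N t <= z)%R <->
  forall i, (i < N)%N -> (gamma i t <= expR z - 1)%R.
Proof.
move=> z0; split=> [/bigmax_leP[_ H] i iN|H].
  by rewrite -ln1D_le//; exact: (H (Ordinal iN)).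
by apply/bigmax_leP; split => // i _; rewrite ln1D_le// H.
Qed.

Lemma rate_max_mono (gamma gamma' : nat -> {RV P >-> R}) N t :
  (forall i, gamma i t <= gamma' i t)%R ->
  (rate_max gamma N t <= rate_max gamma' N t)%R.
Proof.
(* With its default value [ln] is not monotone, so the comparison goes through the SINR levels, at
   [z] equal to the larger maximum. *)
move=> gg'; rewrite rate_max_le ?rate_max_ge0// => i iN.
apply: le_trans (gg' i) _; move: i iN.
by rewrite -rate_max_le ?rate_max_ge0.
Qed.

End rate_max_theory.

(** * The Gumbel limit of the maximal rate *)

Section extreme_value.
Local Open Scope ereal_scope.
Context d (T : measurableType d) (R : realType) (P : probability T R).
Variables (gamma : nat -> {RV P >-> R}) (G : R -> R) (L : R).
Hypothesis L_gt0 : (0 < L)%R.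
Hypothesis G01 : forall y, (0 <= G y <= 1)%R.
Hypothesis G_tail : (y * (1 - G y))%R @[y --> +oo%R] --> L.
Hypothesis gamma_rays : forall N y, (0 < y)%R ->
  P [set t | forall i, (i < N)%N -> (gamma i t <= y)%R] = (G y ^+ N)%:E.

Lemma rate_max_cdf N z : (0 < z)%R ->
  P [set t | (rate_max gamma N t <= z)%R] = (G (expR z - 1) ^+ N)%:E.
Proof.
move=> z0; rewrite -gamma_rays ?subr_gt0 ?expR_gt1//; congr (P _).
by apply/seteqP; split=> t /= /(rate_max_le _ _ _ (ltW z0)).
Qed.

Section gumbel_limit.
Variables (b : nat -> R) (x : R).
Hypothesis b1 : b n @[n --> \oo] --> (1%R : R).

(** [z n] is the Gumbel level for the rate and [y n] the matching level for the SINR, equivalent to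
    [n * (L * expR x)]. *)
Let z (n : nat) : R := (ln (1 + L * n%:R) + b n * x)%R.
Let y (n : nat) : R := (expR (z n) - 1)%R.

Let cvg_yn : (y n / n%:R)%R @[n --> \oo] --> (L * expR x)%R.
Proof.
have H : ((n%:R^-1 + L) * expR (b n * x) - n%:R^-1)%R @[n --> \oo] --> (L *
  expR x)%R.
  have -> : (L * expR x = (0 + L) * expR (1 * x) - 0)%R.
    by rewrite add0r mul1r subr0.
  apply: cvgB; last exact: cvgn_natr_inv.
  apply: cvgM; first by apply: cvgD; [exact: cvgn_natr_inv|exact: cvg_cst].
  apply: continuous_cvg; first exact: continuous_expR.
  by apply: cvgM => //; exact: cvg_cst.
apply: cvg_trans H; apply: near_eq_cvg; exists 1%N => // n /= n1.
have n0 : (0 < n%:R :> R)%R by rewrite ltr0n.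
rewrite /y /z expRD lnK ?posrE ?addr_gt0 ?mulr_gt0//.
by field; rewrite gt_eqF.
Qed.

Let cvg_y : y n @[n --> \oo] --> +oo%R.
Proof.
have l0 : (0 < L * expR x)%R by rewrite mulr_gt0// expR_gt0.
(* Eventually [y n / n] exceeds half its limit, so [y n] grows at least linearly. *)
have := cvg_yn => /cvgr_gt/(_ (L * expR x / 2)%R).
rewrite ltr_pdivrMr// ltr_pMr// ltr1n => /(_ isT) H.
apply/cvgryPge => A.
have := @cvgr_idn R => /cvgryPge/(_ (A / (L * expR x / 2))%R) => H2.
have H3 : \forall n \near \oo, (0 < n)%N by exists 1%N.
apply: filterS3 H H2 H3 => n Hn nA n0.
have n0' : (0 < n%:R :> R)%R by rewrite ltr0n.
move: Hn; rewrite ltr_pdivlMr// => /ltW; apply: le_trans.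
by rewrite mulrC -ler_pdivrMr// divr_gt0.
Qed.

(** [n * (1 - G (y n))] is the quotient of [y n * (1 - G (y n))], tending to [L], by [y n / n],
    tending to [L * expR x]; its limit [expR (- x)] enters [cvg_pow_expR]. *)
Lemma rate_max_gumbel :
  P [set t | (rate_max gamma n t <= z n)%R] @[n --> \oo] -->
    (gumbel_cdf 0 1 x)%:E.
Proof.
have z_gt0 : \forall n \near \oo, (0 < z n)%R.
  have : \forall n \near \oo, (0 < y n)%R by move/cvgryPgt : cvg_y; exact.
  by apply: filterS => n; rewrite /y subr_gt0 -expR0 ltr_expR.
have -> : gumbel_cdf 0 1 x = expR (- (L / (L * expR x))).
  rewrite /gumbel_cdf subr0 divr1; congr (expR (- _)).
  by rewrite expRN; field; rewrite !gt_eqF// expR_gt0.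
suff H : (G (y n) ^+ n)%R @[n --> \oo] --> expR (- (L / (L * expR x))).
  have : (G (y n) ^+ n)%:E @[n --> \oo] --> (expR (- (L / (L * expR x))))%:E.
    by apply: cvg_EFin => //; exact: nearW.
  apply: cvg_trans; apply: near_eq_cvg.
  by apply: filterS z_gt0 => n zn0; rewrite rate_max_cdf.
under eq_fun do rewrite -[G _](subKr 1%R).
apply: cvg_pow_expR.
  by move=> n; have := G01 (y n); lra.
have H : (y n * (1 - G (y n)) / (y n / n%:R))%R @[n --> \oo] --> (L / (L * expR
  x))%R.
  apply: cvgM; first exact: (cvg_comp _ _ cvg_y G_tail).
  by apply: cvgV => //; rewrite gt_eqF// mulr_gt0// expR_gt0.
apply: cvg_trans H; apply: near_eq_cvg.
have H2 : \forall n \near \oo, (0 < y n)%R by move/cvgryPgt : cvg_y; exact.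
have H3 : \forall n \near \oo, (0 < n)%N by exists 1%N.
apply: filterS2 H2 H3 => n yn0 n0.
have n0' : (0 < n%:R :> R)%R by rewrite ltr0n.
by field; rewrite !gt_eqF.
Qed.

End gumbel_limit.
End extreme_value.

(** * The mean of the maximal rate *)

Section mean_capacity_bounds.
Local Open Scope ereal_scope.
Context d (T : measurableType d) (R : realType) (P : probability T R).
Variables (gamma : nat -> {RV P >-> R}) (G : R -> R) (L B : R).
Hypothesis L_gt0 : (0 < L)%R.
Hypothesis G01 : forall y, (0 <= G y <= 1)%R.
Hypothesis G_tail : (y * (1 - G y))%R @[y --> +oo%R] --> L.
Hypothesis G_tail_le : forall y, (0 < y)%R -> (y * (1 - G y) <= B)%R.
Hypothesis gamma_rays : forall N y, (0 < y)%R ->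
  P [set t | forall i, (i < N)%N -> (gamma i t <= y)%R] = (G y ^+ N)%:E.

Lemma bernoulli_le (u : R) N : (0 <= u <= 1)%R -> (1 - N%:R * u <= (1 - u) ^+
  N)%R.
Proof.
move=> /andP[u0 u1]; elim: N => [|N IH]; first by rewrite mul0r subr0 expr0.
rewrite exprS; apply: (@le_trans _ _ ((1 - u) * (1 - N%:R * u))%R); last first.
  by rewrite ler_wpM2l// subr_ge0.
have : (0 <= N%:R * (u * u))%R by rewrite mulr_ge0// mulr_ge0.
by rewrite -natr1; nra.
Qed.

Let B_ge0 : (0 <= B)%R.
Proof.
apply: le_trans (G_tail_le (@ltr01 R)); rewrite mul1r.
by have := G01 1; lra.
Qed.

Lemma measurable_rate_max_gt N z :
  measurable [set t | (z < rate_max gamma N t)%R].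
Proof. by apply: measurable_lt_set => //; exact: measurable_rate_max. Qed.

Lemma rate_max_gt_setC N z : [set t | (z < rate_max gamma N t)%R] =
  ~` [set t | (rate_max gamma N t <= z)%R].
Proof. by apply/seteqP; split=> t /=; rewrite ltNge => /negP. Qed.

(** Bernoulli's inequality acts as a union bound. With [y = expR z - 1], adding [y * (1 - G y) <= B]
    and [1 - G y <= 1] gives [expR z * (1 - G y) <= B + 1]. *)
Lemma rate_max_tail N z : (0 < N)%N -> (0 <= z)%R ->
  P [set t | (z < rate_max gamma N t)%R] <= (N%:R * ((B + 1) * expR (- z)))%:E.
Proof.
move=> N0; rewrite le_eqVlt => /predU1P[<-|z0].
  (* The distribution function of the maximum is given for [z > 0]; at 0 the bound is at least 1. *)
  apply: (@le_trans _ _ 1); first exact/probability_le1/measurable_rate_max_gt.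
  rewrite oppr0 expR0 mulr1 lee_fin.
  by rewrite mulr_ege1 ?ler1n// lerDr.
have mle : measurable [set t | (rate_max gamma N t <= z)%R].
  by rewrite -[X in measurable X]setCK -rate_max_gt_setC;
    exact/measurableC/measurable_rate_max_gt.
rewrite rate_max_gt_setC probability_setC// (rate_max_cdf gamma_rays)// -EFinB
  lee_fin.
have e1 : (0 < expR z - 1)%R by rewrite subr_gt0 expR_gt1.
have := G_tail_le e1; have := G01 (expR z - 1);
  set y := (expR z - 1)%R => Gy yB.
have u01 : (0 <= 1 - G y <= 1)%R by lra.
have := bernoulli_le N u01; rewrite subKr => H.
apply: (@le_trans _ _ (N%:R * (1 - G y))%R); first by lra.
apply: ler_wpM2l => //; rewrite expRN ler_pdivlMr ?expR_gt0//.
have -> : expR z = (y + 1)%R by rewrite /y subrK.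
by nra.
Qed.

(** The number of naturals below [y] is at least [y]; cutting at [n] keeps the count finite. *)
Lemma le_sum_lt (y : R) n :
  (Num.min y n%:R <= \sum_(0 <= k < n) (k%:R < y)%R%:R)%R.
Proof.
elim: n => [|n IH]; first by rewrite big_nil ge_min lexx orbT.
rewrite big_nat_recr//=; have [ny|yn] := ltP (n%:R)%R y.
  rewrite (le_trans _ (lerD IH (lexx _)))//.
  have -> : Num.min y n%:R = n%:R%R by apply/min_idPr/ltW.
  by rewrite ge_min -natr1 lexx orbT.
rewrite addr0 (le_trans _ IH)//.
have -> : Num.min y n%:R = y by apply/min_idPl.
by rewrite ge_min lexx.
Qed.

(** The level [a = ln N] cancels the factor [N] of the tail bound at [a + k], leaving
    [(B + 1) * expR (- k)]; comparison with powers of [1 / 2] gives the constant. *)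
Lemma integral_rate_max_le N : (0 < N)%N ->
  \int[P]_t (rate_max gamma N t)%:E <= (ln N%:R + (B + 1) * 2)%:E.
Proof.
move=> N0; set a := ln N%:R.
have N1 : (1 <= N%:R :> R)%R by rewrite ler1n.
have a0 : (0 <= a)%R by rewrite ln_ge0.
pose E (k : nat) := [set t | (a + k%:R < rate_max gamma N t)%R].
have mE k : measurable (E k) by exact: measurable_rate_max_gt.
pose f k t : \bar R := (\1_(E k) t)%:E.
have f0 k t : 0 <= f k t by rewrite lee_fin.
have mf k : measurable_fun [set: T] (f k) by exact/measurable_EFinP.
(* The sum counts the [k] with [a + k] below the maximal rate. *)
have ptw t : (rate_max gamma N t)%:E <= a%:E + \sum_(k <oo) f k t.
  have [n Hn] : exists n : nat, (rate_max gamma N t - a <= n%:R)%R.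
    by exists (Num.truncn (rate_max gamma N t - a)).+1;
      rewrite ltW// truncnS_gt.
  rewrite -leeBlDl// -EFinB.
  apply: (@le_trans _ _ (\sum_(0 <= k < n) f k t)); last first.
    by apply: nneseries_lim_ge => k _ _.
  rewrite /f sumEFin lee_fin.
  have := le_sum_lt (rate_max gamma N t - a) n.
  have -> : Num.min (rate_max gamma N t - a)%R n%:R = (rate_max gamma N t -
    a)%R.
    exact/min_idPl.
  move=> /le_trans; apply; apply: ler_sum => k _.
  by rewrite indicE /E mem_setE /= ltrBrDl.
apply: (@le_trans _ _ (\int[P]_t (a%:E + \sum_(k <oo) f k t))).
  apply: ge0_le_integral => //.
  - by move=> t _; rewrite lee_fin rate_max_ge0.
  - by apply/measurable_EFinP; exact: measurable_rate_max.
  - apply: emeasurable_funD => //.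
    exact: ge0_emeasurable_sum.
rewrite ge0_integralD//; last 2 first.
- by move=> t _; apply: nneseries_ge0 => k _ _.
- exact: ge0_emeasurable_sum.
have := expectation_cst P a; rewrite unlock /= => ->; rewrite EFinD leeD2l//.
rewrite integral_nneseries//.
(* The terms are [(B + 1) / 2 ^ k], written with exponent [k.+1] to fit the series of
   [epsilon_trick0]. *)
have : \sum_(k <oo) (((B + 1) * 2) / (2 ^ k.+1)%:R)%:E <= ((B + 1) * 2)%:E.
  by apply: epsilon_trick0; rewrite mulr_ge0// addr_ge0.
apply: le_trans; apply: lee_nneseries => k _.
  by move=> _; exact: integral_ge0.
rewrite integral_indic// setIT.
apply: (le_trans (rate_max_tail _ _)) => //; first by rewrite addr_ge0.
rewrite lee_fin opprD expRD expRN /a lnK ?posrE ?ltr0n//.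
have n0 : (N%:R != 0 :> R)%R by rewrite pnatr_eq0 -lt0n.
have -> : (N%:R * ((B + 1) * (N%:R^-1 * expR (- k%:R))) = (B + 1) * expR (-
  k%:R))%R.
  by field.
rewrite -mulrA ler_wpM2l ?addr_ge0//.
rewrite expnS natrM invfM mulrA mulfV// mul1r expRN lef_pV2 ?posrE ?expR_gt0
  ?ltr0n ?expn_gt0//.
rewrite natrX -[k%:R]mulr1 expRM_natl lerXn2r ?nnegrE ?expR_ge0//.
(* [2 <= expR 1] comes from [1 + 1 <= expR 1]. *)
by rewrite (le_trans _ (expR_ge1Dx _)).
Qed.

Lemma integrable_rate_max N : (0 < N)%N ->
  P.-integrable [set: T] (fun t => (rate_max gamma N t)%:E).
Proof.
move=> N0; apply/integrableP; split.
  by apply/measurable_EFinP; exact: measurable_rate_max.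
under eq_integral do rewrite gee0_abs ?lee_fin ?rate_max_ge0//.
exact: le_lt_trans (integral_rate_max_le N0) (ltry _).
Qed.

(** Markov's inequality: [z] times the indicator of exceeding [z] stays below the rate. *)
Lemma mean_rate_max_ge N z : (0 < z)%R ->
  (z * (1 - G (expR z - 1) ^+ N))%:E <= \int[P]_t (rate_max gamma N t)%:E.
Proof.
move=> z0; have mE := measurable_rate_max_gt N z.
have mle : measurable [set t | (rate_max gamma N t <= z)%R].
  by rewrite -[X in measurable X]setCK -rate_max_gt_setC; exact: measurableC.
have -> : (z * (1 - G (expR z - 1) ^+ N))%:E =
    z%:E * P [set t | (z < rate_max gamma N t)%R].
  by rewrite rate_max_gt_setC probability_setC// (rate_max_cdf gamma_rays).
have -> : P [set t | (z < rate_max gamma N t)%R] =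
    \int[P]_t (\1_[set t | (z < rate_max gamma N t)%R] t)%:E.
  by rewrite integral_indic// setIT.
rewrite -ge0_integralZl//; last 2 first.
- exact/measurable_EFinP.
- by rewrite lee_fin ltW.
apply: ge0_le_integral => //.
- by move=> t _; rewrite -EFinM lee_fin mulr_ge0// ltW.
- by apply: emeasurable_funM => //; exact/measurable_EFinP.
- by apply/measurable_EFinP; exact: measurable_rate_max.
- move=> t _; rewrite -EFinM lee_fin indicE.
  have [zR|Rz] := ltP z (rate_max gamma N t);
    first by rewrite mem_set//= mulr1 ltW.
  rewrite memNset/= ?mulr0 ?rate_max_ge0//.
  by apply/negP; rewrite -leNgt.
Qed.

Lemma mean_rate_max_cvg :
  'E_P[rate_max gamma N] * ((ln N%:R)^-1)%:E @[N --> \oo] --> 1.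
Proof.
have intE N : 'E_P[rate_max gamma N] = \int[P]_t (rate_max gamma N t)%:E.
  by rewrite unlock.
have Efin N : (0 < N)%N -> 'E_P[rate_max gamma N] \is a fin_num.
  by move=> N0; rewrite intE; exact/integrable_fin_num/integrable_rate_max.
pose e N := fine 'E_P[rate_max gamma N].
suff H : (e n / ln n%:R)%R @[n --> \oo] --> (1%R : R).
  have : (e n / ln n%:R)%:E @[n --> \oo] --> (1%R : R)%:E.
    by apply: cvg_EFin => //; exact: nearW.
  apply: cvg_trans; apply: near_eq_cvg; exists 1%N => // n /= n1.
  by rewrite EFinM fineK// Efin.
have lnV0 : (ln (n%:R : R))^-1%R @[n --> \oo] --> (0%R : R).
  apply/gtr0_cvgV0; last exact: cvg_lnn.
  by move/cvgryPgt : (@cvg_lnn R); exact.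
apply/cvgrPdist_le => eps eps0.
have up : \forall n \near \oo, (e n / ln n%:R <= 1 + eps)%R.
  have H : ((B + 1) * 2 / ln n%:R)%R @[n --> \oo] --> (0%R : R).
    by rewrite -(mulr0 ((B + 1) * 2)%R); apply: cvgM => //; exact: cvg_cst.
  have {}H : \forall n \near \oo, ((B + 1) * 2 / ln n%:R < eps)%R.
    by move/cvgr_lt : H; exact.
  have H2 : \forall n \near \oo, (1 < n)%N by exists 2%N.
  apply: filterS2 H H2 => n H n1.
  have n0 : (0 < n)%N by exact: ltnW.
  have l0 : (0 < ln (n%:R : R))%R by rewrite ln_gt0// ltr1n.
  have : (e n <= ln n%:R + (B + 1) * 2)%R.
    by rewrite -lee_fin fineK ?Efin// intE integral_rate_max_le.
  move=> /(ler_wpM2r (ltW (_ : 0 < (ln n%:R)^-1)%R));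
    rewrite invr_gt0 l0 => /(_ isT).
  by move=> /le_trans; apply; rewrite mulrDl mulfV ?gt_eqF// lerD2l ltW.
have lo : \forall n \near \oo, (1 - eps <= e n / ln n%:R)%R.
  (* Chosen so that the Gumbel distribution function at [x] is below [eps]. *)
  pose x := ln (eps / 2).
  pose z (n : nat) : R := (ln (1 + L * n%:R) + 1 * x)%R.
  have zr : (z n / ln n%:R)%R @[n --> \oo] --> (1%R : R).
    by apply: cvg_ln_ratio => //; exact: cvg_cst.
  have ln_gt0 : \forall n \near \oo, (0 < ln (n%:R : R))%R.
    by move/cvgryPgt : (@cvg_lnn R); exact.
  have z_gt0 : \forall n \near \oo, (0 < z n)%R.
    have H : \forall n \near \oo, (0 < z n / ln n%:R)%R.
      by move/cvgr_gt : zr; exact.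
    by apply: filterS2 H ln_gt0 => n + l0; rewrite pmulr_lgt0 ?invr_gt0.
  (* The value is [expR (- (2 / eps))], below [eps / 2] because [t < expR t]. *)
  have gx : (gumbel_cdf 0 1 x < eps)%R.
    rewrite /gumbel_cdf subr0 divr1 !expRN lnK ?posrE ?divr_gt0// invf_div.
    apply: (@lt_trans _ _ (2 / eps)^-1%R).
      rewrite ltf_pV2 ?posrE ?expR_gt0 ?divr_gt0//.
      by apply: lt_le_trans (expR_ge1Dx _); rewrite ltrDr.
    by rewrite invf_div ltr_pdivrMr// ltr_pMr// ltr1n.
  (* The Gumbel limit is taken with constant scale 1, which makes its level [z n]. *)
  have b1 : (cst 1%R : nat -> R) n @[n --> \oo] --> (1%R : R) by exact: cvg_cst.
  have /fine_cvg Gn := rate_max_gumbel L_gt0 G01 G_tail gamma_rays (x := x) b1.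
  have H : (z n / ln n%:R * (1 - fine (P [set t | (rate_max gamma n t <= z
    n)%R])))%R
      @[n --> \oo] --> (1 * (1 - gumbel_cdf 0 1 x))%R.
    by apply: cvgM => //; apply: cvgB; [exact: cvg_cst|exact: Gn].
  have {}H : \forall n \near \oo, (1 - eps <
      z n / ln n%:R * (1 - fine (P [set t | (rate_max gamma n t <= z n)%R])))%R.
    by move/cvgr_gt : H; apply; rewrite mul1r; lra.
  have H3 : \forall n \near \oo, (0 < n)%N by exists 1%N.
  apply: filterS2 (filterI H z_gt0) (filterI ln_gt0 H3) => n [{}H z0] [l0 n0].
  apply: (le_trans (ltW H)); rewrite (rate_max_cdf gamma_rays n z0) /= mulrAC.
  rewrite ler_pM2r ?invr_gt0// -lee_fin /e fineK ?Efin// intE.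
  exact: mean_rate_max_ge.
apply: filterS2 up lo => n up lo.
by rewrite ler_distl; apply/andP; split; lra.
Qed.

End mean_capacity_bounds.

(** * The interference power limited regime *)

Section gumbel_constants.
Context {R : realType}.
Variables (Q Pp sigma2 gbar hbar qbar : R).
Hypotheses (Q_gt0 : 0 < Q) (Pp_gt0 : 0 < Pp) (sigma2_gt0 : 0 < sigma2)
  (gbar_gt0 : 0 < gbar) (hbar_gt0 : 0 < hbar) (qbar_gt0 : 0 < qbar).

Let F : R -> R := F_iplr Q Pp sigma2 gbar hbar qbar.
Let c := c_p Pp sigma2 qbar.
Let L := c * (Q * gbar / hbar).

Let c_gt0 : 0 < c. Proof. exact: c_p_gt0. Qed.

Lemma iplr_scale_gt0 : 0 < L.
Proof. by rewrite mulr_gt0// divr_gt0// mulr_gt0. Qed.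

Let L_gt0 := iplr_scale_gt0.

Lemma F_iplrE x : F x = 1 - L / x.
Proof. by rewrite /F /F_iplr -/c /L invfM; congr (1 - _); ring. Qed.

(** On positive [x], [y <= F x] means [L / (1 - y) <= x], so the infimum runs over a closed ray and
    is its endpoint. *)
Let quantile_scaled y : y < 1 -> quantile F y = L / (1 - y).
Proof.
move=> y1; have d0 : 0 < 1 - y by rewrite subr_gt0.
have m0 : 0 < L / (1 - y) by rewrite divr_gt0.
have FE x : 0 < x -> (y <= F x) = (L / (1 - y) <= x).
  move=> x0; rewrite F_iplrE lerBrDr addrC -lerBrDr ler_pdivrMr//.
  by rewrite ler_pdivrMr// mulrC.
rewrite /quantile; apply/eqP; rewrite eq_le; apply/andP; split.
  apply: ge_inf; first by exists 0 => x /= [/ltW].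
  by split => //; rewrite FE.
apply: lb_le_inf; first by exists (L / (1 - y)); split => //; rewrite FE.
by move=> x /= [x0]; rewrite FE.
Qed.

Lemma quantile_iplr y : y < 1 ->
  quantile F y = c * (Q * gbar / ((1 - y) * hbar)).
Proof.
by move=> y1; rewrite quantile_scaled// /L invfM; ring.
Qed.

Lemma F_quantile_iplr y : y < 1 -> F (quantile F y) = y.
Proof.
move=> y1; rewrite quantile_scaled// F_iplrE; field.
by rewrite !gt_eqF ?subr_gt0.
Qed.

Lemma quantile_F_iplr x : 0 < x -> quantile F (F x) = x.
Proof.
move=> x0; rewrite quantile_scaled F_iplrE;
  last by rewrite ltrBlDr ltrDl divr_gt0.
by rewrite subKr invf_div mulrC divfK// gt_eqF.
Qed.

(** [N] is real here, so that both [N] and [N * expR 1] are covered. *)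
Lemma quantile_iplr_inv N : 0 < N -> quantile F (1 - N^-1) = L * N.
Proof.
move=> N0; rewrite quantile_scaled ?subKr ?invrK//.
by rewrite ltrBlDr ltrDl invr_gt0.
Qed.

Lemma gumbel_a_iplr N : (0 < N)%N -> gumbel_a F N = ln (1 + L * N%:R).
Proof. by move=> N0; rewrite /gumbel_a quantile_iplr_inv// ltr0n. Qed.

Lemma gumbel_b_iplr N : (0 < N)%N -> gumbel_b F N =
  ln ((1 + L * (N%:R * expR 1)) / (1 + L * N%:R)).
Proof.
move=> N0; have n0 : 0 < N%:R :> R by rewrite ltr0n.
by rewrite /gumbel_b !quantile_iplr_inv// mulr_gt0// expR_gt0.
Qed.

(** Dividing numerator and denominator by [N] gives a ratio tending to [L * expR 1 / L]. *)
Lemma gumbel_b_iplr_cvg : gumbel_b F N @[N --> \oo] --> (1 : R).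
Proof.
have H : ln ((N%:R^-1 + L * expR 1) / (N%:R^-1 + L)) @[N --> \oo] --> (1 : R).
  have e1 : ln ((0 + L * expR 1) / (0 + L)) = 1.
    by rewrite !add0r [L * _]mulrC mulfK ?gt_eqF// expRK.
  rewrite -[X in _ --> X]e1; apply: continuous_cvg.
    by apply: continuous_ln; rewrite !add0r divr_gt0// mulr_gt0// expR_gt0.
  apply: cvgM; first by apply: cvgD; [exact: cvgn_natr_inv|exact: cvg_cst].
  apply: cvgV; first by rewrite add0r gt_eqF.
  by apply: cvgD; [exact: cvgn_natr_inv|exact: cvg_cst].
apply: cvg_trans H; apply: near_eq_cvg; exists 1%N => // n /= n1.
have n0 : 0 < n%:R :> R by rewrite ltr0n.
rewrite gumbel_b_iplr//; congr ln; field.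
by rewrite !gt_eqF// addr_gt0// mulr_gt0.
Qed.

Lemma asymptotic_capacity_iplr N : (0 < N)%N ->
  asymptotic_capacity F N = ln (1 + L * N%:R) + euler_const.
Proof.
move=> N0; rewrite /asymptotic_capacity /gumbel_capacity gumbel_a_iplr//.
by rewrite (cvg_lim _ gumbel_b_iplr_cvg)// mul1r.
Qed.

Lemma asymptotic_capacity_iplr_cvg :
  asymptotic_capacity F N / ln N%:R @[N --> \oo] --> (1 : R).
Proof.
have H : (ln (1 + L * n%:R) + euler_const) / ln n%:R @[n --> \oo] --> (1 : R).
  by apply: cvg_ln_ratio => //; exact: cvg_cst.
apply: cvg_trans H; apply: near_eq_cvg; exists 1%N => // n /= n1.
by rewrite asymptotic_capacity_iplr.
Qed.

End gumbel_constants.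

(** * Mean capacity as the power constraint is lifted *)

Section mean_capacity_limit.
Context d (T : measurableType d) (R : realType) (P : probability T R).
Variables (Q Pp sigma2 gbar hbar qbar : R) (g h q : nat -> {RV P >-> R}).
Hypotheses (Pp_gt0 : 0 < Pp) (sigma2_gt0 : 0 < sigma2) (gbar_gt0 : 0 < gbar)
  (hbar_gt0 : 0 < hbar) (qbar_gt0 : 0 < qbar).
Hypotheses (g_exp : forall i, exponential_with_mean (g i) gbar)
  (h_exp : forall i, exponential_with_mean (h i) hbar)
  (q_exp : forall i, exponential_with_mean (q i) qbar).

Let gamma M (i : nat) : {RV P >-> R} := sinr Q Pp sigma2 (g i) (h i) (q i) M.
Let gammaI (i : nat) : {RV P >-> R} := sinr_iplr Q Pp sigma2 (g i) (h i) (q i).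

(** Dominated convergence: the minimum is at most its first term, so the maximal rate without power
    constraint is a bound for every [M]. *)
Lemma mean_capacity_cvg N :
  P.-integrable [set: T] (fun t => (rate_max gammaI N t)%:E) ->
  mean_capacity (gamma M) N @[M --> +oo] --> mean_capacity gammaI N.
Proof.
move=> intI; rewrite /mean_capacity unlock.
apply: (@dominated_cvg_pinfty _ _ _ P (fun M t => (rate_max (gamma M) N t)%:E)
  (fun t => (rate_max gammaI N t)%:E) (fun t => (rate_max gammaI N t)%:E)) =>
    //.
- by move=> M _; apply/measurable_EFinP; exact: measurable_rate_max.
- by apply/measurable_EFinP; exact: measurable_rate_max.
- have := all_sinr_near_iplr Q Pp_gt0 sigma2_gt0 gbar_gt0 hbar_gt0 qbar_gt0
    g_exp h_exp q_exp N.
  apply: filterS => t H; apply: cvg_near_cst; apply: filterS H => M H.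
  congr EFin; apply: eq_bigr => i _.
  by rewrite /gamma /gammaI /sinr /sinr_iplr /= H.
- move=> M t _; rewrite gee0_abs ?lee_fin ?rate_max_ge0//.
  by apply: rate_max_mono => i; rewrite /gamma /sinr /= /sinr_fun ge_min lexx.
Qed.

End mean_capacity_limit.

Theorem mainTheorem4 (d : measure_display) (T : measurableType d)
  (R : realType) (P : probability T R)
  (Q Pp sigma2 gbar hbar qbar : R)
  (g h q : nat -> {RV P >-> R})
  (Q_gt0 : 0 < Q) (Pp_gt0 : 0 < Pp) (sigma2_gt0 : 0 < sigma2)
  (gbar_gt0 : 0 < gbar) (hbar_gt0 : 0 < hbar) (qbar_gt0 : 0 < qbar)
  (g_exp : forall i, exponential_with_mean (g i) gbar)
  (h_exp : forall i, exponential_with_mean (h i) hbar)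
  (q_exp : forall i, exponential_with_mean (q i) qbar)
  (ghq_indep : forall i,
     mutually_independent (tnth [tuple g i; h i; q i]))
  (sinr_indep : forall Pmax : R, 0 < Pmax ->
     mutually_independent (fun i => sinr Q Pp sigma2 (g i) (h i) (q i) Pmax)) :
  let gamma (Pmax : R) (i : nat) : {RV P >-> R} :=
    sinr Q Pp sigma2 (g i) (h i) (q i) Pmax in
  let gammaI (i : nat) : {RV P >-> R} :=
    sinr_iplr Q Pp sigma2 (g i) (h i) (q i) in
  let F : R -> R := F_iplr Q Pp sigma2 gbar hbar qbar in
  let c : R := c_p Pp sigma2 qbar in
  [/\ (* F is the asymptotic distribution function of the SINR *)
      [/\ forall i x, cdf (gamma Pmax i) x @[Pmax --> +oo] --> cdf (gammaI i) x
        & forall i,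
            (1 - fine (cdf (gammaI i) x)) / (1 - F x) @[x --> +oo] --> (1 : R)],
      (* the inverse of F *)
      [/\ forall y, y < 1 ->
            quantile F y = c * (Q * gbar / ((1 - y) * hbar)),
          forall y, y < 1 -> F (quantile F y) = y
        & forall x, 0 < x -> quantile F (F x) = x],
      (* the normalizing constants *)
      [/\ forall N : nat, (0 < N)%N ->
            gumbel_a F N = ln (1 + c * (Q * gbar / hbar) * N%:R),
          forall N : nat, (0 < N)%N ->
            gumbel_b F N =
            ln ((1 + c * (Q * gbar / hbar) * (N%:R * expR 1)) /
                (1 + c * (Q * gbar / hbar) * N%:R)),
          gumbel_b F N @[N --> \oo] --> (1 : R)
        & forall x,
            P [set t | rate_max gammaI N t <= gumbel_a F N + gumbel_b F N * x]
              @[N --> \oo] --> (gumbel_cdf 0 1 x)%:E],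
      (* the asymptotic mean capacity *)
      (forall N : nat, (0 < N)%N ->
         asymptotic_capacity F N =
         ln (1 + c * (Q * gbar / hbar) * N%:R) + euler_const)
    & (* scaling as log N *)
      [/\ asymptotic_capacity F N / ln N%:R @[N --> \oo] --> (1 : R),
          forall N : nat, (0 < N)%N ->
            mean_capacity (gamma Pmax) N @[Pmax --> +oo]
              --> mean_capacity gammaI N
        & (mean_capacity gammaI N * ((ln N%:R)^-1)%:E)%E
            @[N --> \oo] --> 1%E]].

Proof.
set c := c_p Pp sigma2 qbar; set F := F_iplr Q Pp sigma2 gbar hbar qbar.
move=> gamma gammaI; pose L := c * (Q * gbar / hbar).
have c_gt0 : 0 < c by exact: c_p_gt0.
have L_gt0 : 0 < L by exact: iplr_scale_gt0.
(* Antenna 0 stands for all: at positive [y] the tail formula depends on the parameters alone. *)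
pose G (y : R) : R := fine (cdf (gammaI 0%N) y).
have cdfE i y : 0 < y -> cdf (gammaI i) y = (G y)%:E.
  move=> y0; rewrite /G fineK ?fin_num_measure// !cdf_1_ccdf.
  by congr (1 - _)%E; rewrite /gammaI !(ccdf_sinr_iplr Q_gt0 Pp_gt0 sigma2_gt0
    gbar_gt0 hbar_gt0 qbar_gt0).
have G01 y : 0 <= G y <= 1.
  by rewrite fine_ge0//= -lee_fin fineK ?fin_num_measure// probability_le1.
have G_tail : y * (1 - G y) @[y --> +oo] --> L.
  exact: (sinr_iplr_tail_cvg Q_gt0 Pp_gt0 sigma2_gt0 gbar_gt0 hbar_gt0
    qbar_gt0).
pose B := Q * gbar / (hbar * sigma2).
have G_tail_le y : 0 < y -> y * (1 - G y) <= B.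
  exact: (sinr_iplr_tail_le Q_gt0 Pp_gt0 sigma2_gt0 gbar_gt0 hbar_gt0 qbar_gt0).
have gammaI_rays N y : 0 < y ->
    P [set t | forall i, (i < N)%N -> gammaI i t <= y] = (G y ^+ N)%:E.
  move=> y0; transitivity (\prod_(i < N) cdf (gammaI i) y)%E.
    exact: (sinr_iplr_indep_rays Pp_gt0 sigma2_gt0 gbar_gt0 hbar_gt0 qbar_gt0
      g_exp h_exp q_exp sinr_indep).
  rewrite (prod_cdfE gammaI); congr EFin.
  under eq_bigr do rewrite cdfE//=.
  by rewrite prodr_const card_ord.
have b1 := gumbel_b_iplr_cvg Q_gt0 Pp_gt0 sigma2_gt0 gbar_gt0 hbar_gt0 qbar_gt0.
split.
- split=> [i x|i].
    exact: (cdf_sinr_cvg Pp_gt0 sigma2_gt0 gbar_gt0 hbar_gt0 qbar_gt0).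
  (* [1 - F x] is [L / x], so the ratio of tails is [x * (1 - G x) / L]. *)
  have H : x * (1 - G x) / L @[x --> +oo] --> (1 : R).
    by rewrite -[X in _ --> X](mulfV (x := L)) ?gt_eqF//; apply: cvgM => //;
      exact: cvg_cst.
  apply: cvg_trans H; apply: near_eq_cvg.
  apply: filterS (nbhs_pinfty_gt (num_real 0)) => x x0.
  rewrite /F F_iplrE -/c -/L cdfE//= subKr; field.
  by rewrite !gt_eqF.
- split.
  + exact: quantile_iplr.
  + exact: F_quantile_iplr.
  + exact: quantile_F_iplr.
- split.
  + exact: gumbel_a_iplr.
  + exact: gumbel_b_iplr.
  + exact: b1.
  + move=> x; have H := rate_max_gumbel L_gt0 G01 G_tail gammaI_rays (x := x)
      b1.
    apply: cvg_trans H; apply: near_eq_cvg; exists 1%N => // n /= n1.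
    by rewrite gumbel_a_iplr.
- exact: asymptotic_capacity_iplr.
- split.
  + exact: asymptotic_capacity_iplr_cvg.
  + move=> N N0; apply: (mean_capacity_cvg Pp_gt0 sigma2_gt0 gbar_gt0
      hbar_gt0 qbar_gt0 g_exp h_exp q_exp).
    exact: (integrable_rate_max G01 G_tail_le gammaI_rays).
  + exact: (mean_rate_max_cvg L_gt0 G01 G_tail G_tail_le gammaI_rays).
Qed.
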